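(* Let $u,v\in(0,1)$, $\mathfrak q:=u^2v^2$, and $$\mathscr A_{\mathfrak q}(x):=\sum_{r\ge1}\frac{r x^r}{1-\mathfrak q^r}=(x\partial_x)^2\bigl[-\log(x;\mathfrak q)_\infty\bigr].$$ On every product of contours on which the following series converge normally, define $$\mathscr K^{\mathrm{ann}}_{u,v}(z,w):=\mathscr A_{\mathfrak q}\!\left(\frac wz\right)+\mathscr A_{\mathfrak q}\!\left(\mathfrak q\frac zw\right)+\mathscr A_{\mathfrak q}(u^2zw)+\mathscr A_{\mathfrak q}\!\left(\frac{v^2}{zw}\right).$$ Then the kernel $\mathscr B_{u,v}$ of the context satisfies $$\mathscr B_{u,v}(z,w)=\mathscr A_{\mathfrak q}\!\left(\frac{v^2}{zw}\right)+\mathscr A_{\mathfrak q}(u^2zw)+\mathscr A_{\mathfrak q}\!\left(\mathfrak q\frac wz\right)+\mathscr A_{\mathfrak q}\!\left(\mathfrak q\frac zw\right).$$ Moreover, on nested contours with $|w|<|z|$, $$\frac{zw}{(z-w)^2}+\mathscr B_{u,v}(z,w)=\mathscr K^{\mathrm{ann}}_{u,v}(z,w).$$ Equivalently, $$(z\partial_z)(w\partial_w)\mathscr L_{u,v}(z,w)=\mathscr K^{\mathrm{ann}}_{u,v}(z,w),$$ where $\mathscr L_{u,v}$ is the annular image potential of the context.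
   Context: $(a;\mathfrak q)_\infty=\prod_{k\ge0}(1-a\mathfrak q^k)$. For $r\ge1$ set $$\mathfrak a_r=\sum_{k\ge1}(u^{4k-4}v^{4k-2})^r+\sum_{k\ge1}(u^{4k-2}v^{4k})^r=\frac{v^{2r}+u^{2r}v^{4r}}{1-u^{4r}v^{4r}},$$ $$\mathfrak b_r=\sum_{k\ge1}(u^{4k-2}v^{4k-4})^r+\sum_{k\ge1}(u^{4k}v^{4k-2})^r=\frac{u^{2r}+u^{4r}v^{2r}}{1-u^{4r}v^{4r}},\qquad\mathfrak c_r=\sum_{k\ge1}(u^{2k}v^{2k})^r=\frac{u^{2r}v^{2r}}{1-u^{2r}v^{2r}},$$ and $$\mathscr B_{u,v}(z,w)=\sum_{r\ge1}r\bigl[\mathfrak a_rz^{-r}w^{-r}+\mathfrak b_rz^rw^r+\mathfrak c_r(z^{-r}w^r+z^rw^{-r})\bigr].$$ On contour neighborhoods where the products converge normally and are non-vanishing, $$\mathscr L_{u,v}(z,w)=\log\frac{(w/z;\mathfrak q)_\infty(\mathfrak q z/w;\mathfrak q)_\infty}{(u^2zw;\mathfrak q)_\infty(v^2/(zw);\mathfrak q)_\infty},$$ with a fixed choice of logarithmic branch on the contour system. *)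

(* Defs.v *)
From Stdlib Require Export Reals.
From Coquelicot Require Export Coquelicot.

Open Scope C_scope.

(* Total sum operator, unspecified for divergent series (as [RInt] is for
   non-integrable functions). *)
Definition Cseries (a : nat -> C) : C :=
  iota (fun l : C_CompleteNormedModule => is_series a l).

Definition Cseries1 (a : nat -> C) : C := Cseries (fun n => a (S n)).
Definition Rseries1 (a : nat -> R) : R := Series (fun n => a (S n)).

Fixpoint Cprod (f : nat -> C) (n : nat) : C :=
  match n with
  | O => 1
  | S m => Cprod f m * f m
  end.

Definition qpoch (a q : C) : C :=
  iota (fun l : C_CompleteNormedModule =>
    filterlim (Cprod (fun k => 1 - a * q ^ k)) eventually (locally l)).

Definition cexp (z : C) : C :=
  ((exp (Re z) * cos (Im z))%R, (exp (Re z) * sin (Im z))%R).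

(* [L] is a branch of [log F] on [D]. *)
Definition log_branch {T : UniformSpace} (D : T -> Prop) (F L : T -> C) : Prop :=
  forall p, D p -> continuous (U := C_UniformSpace) L p /\ cexp (L p) = F p.

(* Normal convergence: a summable majorant of the sup norms on [D]. *)
Definition normally_cvg {T : Type} (D : T -> Prop) (f : nat -> T -> C) : Prop :=
  exists M : nat -> R,
    ex_series M /\ forall n p, D p -> (Cmod (f n p) <= M n)%R.

Definition C_ex_derive (f : C -> C) (z : C) : Prop :=
  @ex_derive C_AbsRing C_NormedModule f z.

(* [z d/dz]: total, so meaningful only where [C_ex_derive f z] holds. *)
Definition euler (f : C -> C) (z : C) : C := z * C_derive f z.

Definition A_term (q x : C) (r : nat) : C := INR r * x ^ r / (1 - q ^ r).

Definition Aq (q x : C) : C := Cseries1 (A_term q x).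

Definition A_normal {T : Type} (D : T -> Prop) (q : C) (x : T -> C) : Prop :=
  normally_cvg D (fun n p => A_term q (x p) (S n)).

Definition qq (u v : R) : R := (u ^ 2 * v ^ 2)%R.

Definition coef_a (u v : R) (r : nat) : R :=
  (Rseries1 (fun k => (u ^ (4 * k - 4) * v ^ (4 * k - 2)) ^ r)
   + Rseries1 (fun k => (u ^ (4 * k - 2) * v ^ (4 * k)) ^ r))%R.

Definition coef_b (u v : R) (r : nat) : R :=
  (Rseries1 (fun k => (u ^ (4 * k - 2) * v ^ (4 * k - 4)) ^ r)
   + Rseries1 (fun k => (u ^ (4 * k) * v ^ (4 * k - 2)) ^ r))%R.

Definition coef_c (u v : R) (r : nat) : R :=
  Rseries1 (fun k => (u ^ (2 * k) * v ^ (2 * k)) ^ r)%R.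

Definition B_term (u v : R) (z w : C) (r : nat) : C :=
  INR r * (coef_a u v r * (/ z ^ r * / w ^ r)
           + coef_b u v r * (z ^ r * w ^ r)
           + coef_c u v r * (/ z ^ r * w ^ r + z ^ r * / w ^ r)).

Definition Bker (u v : R) (z w : C) : C := Cseries1 (B_term u v z w).

Definition x_wz (p : C * C) : C := snd p / fst p.
Definition x_qwz (u v : R) (p : C * C) : C := qq u v * (snd p / fst p).
Definition x_qzw (u v : R) (p : C * C) : C := qq u v * (fst p / snd p).
Definition x_uu (u : R) (p : C * C) : C := (u ^ 2)%R * (fst p * snd p).
Definition x_vv (v : R) (p : C * C) : C := (v ^ 2)%R / (fst p * snd p).

Definition Kann (u v : R) (z w : C) : C :=
  Aq (qq u v) (x_wz (z, w)) + Aq (qq u v) (x_qzw u v (z, w))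
  + Aq (qq u v) (x_uu u (z, w)) + Aq (qq u v) (x_vv v (z, w)).

Definition image_quotient (u v : R) (p : C * C) : C :=
  (qpoch (x_wz p) (qq u v) * qpoch (x_qzw u v p) (qq u v))
  / (qpoch (x_uu u p) (qq u v) * qpoch (x_vv v p) (qq u v)).

(* The product of the factors [1 - x(p) q^k] converges normally on [D], i.e.
   the series of the [x(p) q^k] does, and its value does not vanish there. *)
Definition qpoch_good {T : Type} (D : T -> Prop) (q : C) (x : T -> C) : Prop :=
  normally_cvg D (fun k p => x p * q ^ k) /\ forall p, D p -> qpoch (x p) q <> 0.

(* A contour enters only through its set of points, a subset of [C \ {0}]. *)
Definition contour_product (Gz Gw : C -> Prop) (p : C * C) : Prop :=
  Gz (fst p) /\ Gw (snd p).

Definition C2_open (U : C * C -> Prop) : Prop :=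
  @open (prod_UniformSpace C_UniformSpace C_UniformSpace) U.

(* [L] is the image potential, for one choice of branch, on the open set [U]. *)
Definition image_potential (u v : R) (U : C * C -> Prop) (L : C * C -> C) : Prop :=
  C2_open U
  /\ (forall p, U p -> fst p <> 0 /\ snd p <> 0)
  /\ qpoch_good U (qq u v) x_wz
  /\ qpoch_good U (qq u v) (x_qzw u v)
  /\ qpoch_good U (qq u v) (x_uu u)
  /\ qpoch_good U (qq u v) (x_vv v)
  /\ @log_branch (prod_UniformSpace C_UniformSpace C_UniformSpace) U
       (image_quotient u v) L.

(* Main.v *)
Require Import Defs.
From Stdlib Require Import ssreflect Lra Lia.

(* On the unit disc the power series
     psi q x = sum_{r >= 1} x^r / (r (1 - q^r))
   satisfies psi q x - psi q (q x) = - log (1 - x); telescoping over x, q x, q^2 x, ...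
   gives exp (- psi q x) = (x; q)_oo.  Two continuous functions with the same
   exponential differ locally by a constant, so every branch of a logarithm of a
   quotient of such products is locally a signed sum of psi's plus a constant, and its
   Euler derivatives are computed termwise: (x d/dx)^2 psi = A_q.  The normal
   convergence of the A_q series at a point forces its argument to have modulus < 1,
   so all computations take place inside the disc. *)

(** A branch of a logarithm is given only as a continuous function with a prescribed exponential, so
    its differentiability has to be produced before any derivative can be computed; this is why an
    explicit differentiable model [psi] is built. Every series involved has real coefficients, so
    real radii of convergence control absolute convergence on the complex disc. In the mixed
    derivative each of the four arguments is a monomial in z and w. The product of its two exponents
    is -1 for the arguments in the numerator of the image quotient and +1 for those in the
    denominator; this cancels the sign of the corresponding [psi], and all four A_q terms come out
    with a plus sign. *)

(** * Total sums of complex series *)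

Lemma is_Cseries_unique (a : nat -> C) (l : C) :
  @is_series C_AbsRing C_NormedModule a l -> Cseries a = l.
Proof.
intros H.
apply (iota_filterlim_locally (K := C_AbsRing) (V := C_CompleteNormedModule)
  (F := eventually) (sum_n a) l H).
Qed.

Lemma Cseries_correct (a : nat -> C) :
  @ex_series C_AbsRing C_NormedModule a ->
  @is_series C_AbsRing C_NormedModule a (Cseries a).
Proof. intros [l Hl]; now rewrite (is_Cseries_unique a l Hl). Qed.

Lemma Cseries_ext (a b : nat -> C) :
  (forall n, a n = b n) ->
  @ex_series C_AbsRing C_NormedModule b -> Cseries a = Cseries b.
Proof.
intros H Hb; apply is_Cseries_unique.
apply is_series_ext with b; [now intros n | now apply Cseries_correct].
Qed.

Lemma Cseries_plus (a b : nat -> C) :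
  @ex_series C_AbsRing C_NormedModule a ->
  @ex_series C_AbsRing C_NormedModule b ->
  Cseries (fun n => a n + b n) = Cseries a + Cseries b.
Proof.
intros Ha Hb; apply is_Cseries_unique.
apply: is_series_plus; now apply Cseries_correct.
Qed.

(** Serves twice: for absolute convergence of power series in the disc, and for the quadratic
    remainder bound behind their differentiability. *)
Lemma Cmod_Cseries_le (a : nat -> C) (b : nat -> R) :
  (forall n, (Cmod (a n) <= b n)%R) -> ex_series b ->
  @ex_series C_AbsRing C_NormedModule a /\ (Cmod (Cseries a) <= Series b)%R.
Proof.
intros Hab Hb.
assert (Ha : @ex_series C_AbsRing C_NormedModule a).
{ exact (@ex_series_le C_AbsRing C_CompleteNormedModule a b Hab Hb). }
split; trivial.
assert (Hl := Cseries_correct a Ha).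
assert (Hn : is_lim_seq (fun n => Cmod (sum_n (G := C_NormedModule) a n)) (Cmod (Cseries a))).
{ exact (filterlim_comp _ _ _ _ _ _ _ _ Hl (@filterlim_norm C_AbsRing C_NormedModule _)). }
assert (Hs : is_lim_seq (sum_n b) (Series b)) by exact (Series_correct b Hb).
refine (is_lim_seq_le _ _ (Cmod (Cseries a)) (Series b) _ Hn Hs).
intros n; induction n as [|n IH].
- rewrite !sum_O; apply Hab.
- rewrite !sum_Sn; eapply Rle_trans; [apply Cmod_triangle | ].
  now apply Rplus_le_compat.
Qed.

(** * Complex power series with real coefficients on the unit disc *)

(** The coefficients are kept real so that [CV_radius] applies to them directly. *)
Definition Cps (a : nat -> R) (x : C) : C := Cseries (fun n => RtoC (a n) * x ^ n).

Lemma Rbar_lt_CV_radius (a : nat -> R) (r : R) :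
  Rbar_le 1 (CV_radius a) -> (0 <= r)%R -> (r < 1)%R ->
  Rbar_lt (Rabs r) (CV_radius a).
Proof.
intros Ha H0 H1; apply Rbar_lt_le_trans with 1%R; trivial.
now rewrite Rabs_pos_eq.
Qed.

Lemma ex_series_Cps (a : nat -> R) (x : C) :
  Rbar_le 1 (CV_radius a) -> (Cmod x < 1)%R ->
  @ex_series C_AbsRing C_NormedModule (fun n => RtoC (a n) * x ^ n).
Proof.
intros Ha Hx.
apply (fun H Hs => proj1 (Cmod_Cseries_le _ (fun n => Rabs (a n * Cmod x ^ n)) H Hs)).
2:{ apply CV_disk_inside, Rbar_lt_CV_radius; trivial; apply Cmod_ge_0. }
intros n; rewrite Cmod_mult Cmod_R Cmod_pow Rabs_mult (Rabs_pos_eq (_ ^ _)).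
- apply Rle_refl.
- apply pow_le, Cmod_ge_0.
Qed.

Lemma is_series_Cps (a : nat -> R) (x : C) :
  Rbar_le 1 (CV_radius a) -> (Cmod x < 1)%R ->
  @is_series C_AbsRing C_NormedModule (fun n => RtoC (a n) * x ^ n) (Cps a x).
Proof. intros Ha Hx; now apply Cseries_correct, ex_series_Cps. Qed.

Lemma CV_radius_ge_1 (a : nat -> R) (K : R) :
  (forall n, (Rabs (a n) <= K)%R) -> Rbar_le 1 (CV_radius a).
Proof.
intros HK; apply (proj1 (CV_radius_bounded a)).
exists K; intros n; now rewrite pow1 Rmult_1_r.
Qed.

Lemma Cps_decr_1 (a : nat -> R) (x : C) :
  Rbar_le 1 (CV_radius a) -> (Cmod x < 1)%R ->
  Cps a x = a O + x * Cps (PS_decr_1 a) x.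
Proof.
intros Ha Hx; apply is_Cseries_unique.
apply is_series_decr_1.
replace (plus _ _) with (x * Cps (PS_decr_1 a) x).
2:{ change (@eq C (x * Cps (PS_decr_1 a) x)
      (a 0%nat + x * Cps (PS_decr_1 a) x + - (a 0%nat * 1))); ring. }
apply is_series_ext with (fun n => x * (RtoC (PS_decr_1 a n) * x ^ n)).
- intros n; change (@eq C (x * (a (S n) * x ^ n)) (a (S n) * x ^ S n)); rewrite Cpow_S; ring.
- apply: (is_series_scal (V := C_NormedModule)).
  apply is_series_Cps; trivial.
  now rewrite CV_radius_decr_1.
Qed.

(** Coefficients of x a'(x), written without an index shift so that iterates remain explicit
    multiples of [a n]. *)
Definition PS_euler (a : nat -> R) (n : nat) : R := (INR n * a n)%R.

Lemma CV_radius_euler (a : nat -> R) : CV_radius (PS_euler a) = CV_radius a.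
Proof.
rewrite -(CV_radius_derive a) -(CV_radius_incr_1 (PS_derive a)).
apply CV_radius_ext; intros [|n]; unfold PS_euler, PS_incr_1, PS_derive.
- simpl; ring_simplify; reflexivity.
- reflexivity.
Qed.

Lemma Cps_euler (a : nat -> R) (x : C) :
  Rbar_le 1 (CV_radius a) -> (Cmod x < 1)%R ->
  Cps (PS_euler a) x = x * Cps (PS_derive a) x.
Proof.
intros Ha Hx; rewrite Cps_decr_1 ?CV_radius_euler //.
unfold PS_euler at 1; rewrite Rmult_0_l Cplus_0_l.
reflexivity.
Qed.

(** In the induction the remainder is multiplied by [y], and the new error is (n+2) x^(n+1) (y-x)^2.
    The constant (n+2)(n+1), twice the sharp one, leaves room for this and makes the bounds,
    weighted by the coefficients, sum to a second derivative series at [rho]. *)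
Lemma Cpow_taylor2 (x y : C) (rho : R) (n : nat) :
  (Cmod x <= rho)%R -> (Cmod y <= rho)%R ->
  (Cmod (y ^ (S (S n)) - x ^ (S (S n)) - INR (S (S n)) * x ^ (S n) * (y - x))
   <= INR (S (S n)) * INR (S n) * rho ^ n * Cmod (y - x) ^ 2)%R.
Proof.
intros Hx Hy; assert (Hd := Cmod_ge_0 (y - x)).
assert (Hr : (0 <= rho)%R) by (eapply Rle_trans; [apply Cmod_ge_0 | exact Hx]).
induction n as [|n IH].
- replace (_ - _ - _) with ((y - x) * (y - x)).
  2:{ rewrite !S_INR !RtoC_plus; simpl; ring. }
  rewrite Cmod_mult; simpl; nra.
- replace (_ - _ - _) with
    (y * (y ^ (S (S n)) - x ^ (S (S n)) - INR (S (S n)) * x ^ (S n) * (y - x))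
     + INR (S (S n)) * (x ^ S n * ((y - x) * (y - x)))).
  2:{ rewrite (S_INR (S (S n))) RtoC_plus !Cpow_S; ring. }
  eapply Rle_trans; [apply Cmod_triangle | ].
  rewrite !Cmod_mult Cmod_pow Cmod_R (Rabs_pos_eq (INR _)); [ | apply pos_INR].
  assert (H1 : (Cmod x ^ S n <= rho ^ S n)%R).
  { apply pow_incr; split; [apply Cmod_ge_0 | trivial]. }
  assert (H2 := Rmult_le_compat _ _ _ _ (Cmod_ge_0 y) (Cmod_ge_0 _) Hy IH).
  eapply Rle_trans; [apply Rplus_le_compat; [exact H2 | ] | ].
  { apply Rmult_le_compat_l; [apply pos_INR | ].
    apply Rmult_le_compat_r; [ | exact H1].
    nra. }
  assert (H4 : (0 <= rho * rho ^ n * Cmod (y - x) ^ 2)%R).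
  { apply Rmult_le_pos; [apply (pow_le rho (S n) Hr) | apply pow_le, Hd]. }
  apply Rminus_le_0.
  replace (_ - _)%R with (INR (S (S n)) * (rho * rho ^ n * Cmod (y - x) ^ 2))%R.
  + apply Rmult_le_pos; [apply pos_INR | exact H4].
  + rewrite !S_INR; simpl; ring.
Qed.

(** With [rho] midway between |x| and 1, the second-order remainders sum to at most a constant times
    |y-x|^2 on the disc of radius [rho]. The constant [Series b] is the second derivative series
    with absolute values, taken at [rho]. *)
Lemma is_derive_Cps (a : nat -> R) (x : C) :
  Rbar_le 1 (CV_radius a) -> (Cmod x < 1)%R ->
  @is_derive C_AbsRing C_NormedModule (Cps a) x (Cps (PS_derive a) x).
Proof.
intros Ha Hx.
set (rho := ((1 + Cmod x) / 2)%R).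
assert (Hx0 := Cmod_ge_0 x).
assert (Hrho : (Cmod x < rho < 1)%R) by (unfold rho; lra).
set (b := fun n => (INR (S (S n)) * INR (S n) * Rabs (a (S (S n))) * rho ^ n)%R).
assert (Hb : ex_series b).
{ apply ex_series_ext with
    (fun n => Rabs (PS_derive (PS_derive a) n * rho ^ n)).
  - intros n; unfold b, PS_derive.
    rewrite !Rabs_mult (Rabs_pos_eq (INR _)) ?(Rabs_pos_eq (INR (S (S n))))
      ?(Rabs_pos_eq (rho ^ n)); try apply pos_INR; [simpl; ring | apply pow_le; lra].
  - apply CV_disk_inside, Rbar_lt_CV_radius; [now rewrite !CV_radius_derive | lra | lra]. }
assert (HM : (0 <= Series b)%R).
{ rewrite -(Rmult_0_l (Series b)) -Series_scal_l; apply Series_le; trivial.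
  intros n; assert (0 <= b n)%R; [ | lra].
  unfold b; repeat apply Rmult_le_pos; try apply pos_INR; try apply Rabs_pos.
  apply pow_le; lra. }
assert (Hquad : forall y, (Cmod y <= rho)%R ->
  (Cmod (Cps a y - Cps a x - (y - x) * Cps (PS_derive a) x)
   <= Series b * Cmod (y - x) ^ 2)%R).
{ intros y Hy.
  assert (Hy1 : (Cmod y < 1)%R) by lra.
  assert (Ha1 : Rbar_le 1 (CV_radius (PS_derive a))) by now rewrite CV_radius_derive.
  assert (Hd1 : Rbar_le 1 (CV_radius (PS_decr_1 a))) by now rewrite CV_radius_decr_1.
  (* The remainder vanishes in degrees 0 and 1, so two terms are peeled off and [e] is indexed from
     degree 2. *)
  rewrite (Cps_decr_1 a y) // (Cps_decr_1 a x) // (Cps_decr_1 _ y) // (Cps_decr_1 (PS_decr_1 a) x) //.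
  rewrite (Cps_decr_1 (PS_derive a) x) //.
  set (e := fun n => RtoC (a (S (S n)))
    * (y ^ (S (S n)) - x ^ (S (S n)) - INR (S (S n)) * x ^ (S n) * (y - x))).
  assert (He : forall n, (Cmod (e n) <= b n * Cmod (y - x) ^ 2)%R).
  { intros n; unfold e; rewrite Cmod_mult Cmod_R.
    assert (H := Cpow_taylor2 x y rho n ltac:(lra) Hy).
    apply Rmult_le_compat_l with (r := Rabs (a (S (S n)))) in H; [ | apply Rabs_pos].
    unfold b; lra. }
  destruct (Cmod_Cseries_le e _ He) as [_ Hle].
  { now apply ex_series_scal_r. }
  rewrite Series_scal_r in Hle.
  eapply Rle_trans; [ | exact Hle]; right; f_equal.
  symmetry; apply is_Cseries_unique.
  set (p := PS_decr_1 (PS_decr_1 a)); set (d := PS_decr_1 (PS_derive a)).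
  assert (Hp : Rbar_le 1 (CV_radius p)) by now unfold p; rewrite CV_radius_decr_1.
  assert (Hd : Rbar_le 1 (CV_radius d)) by now unfold d; rewrite CV_radius_decr_1.
  assert (S1 := is_series_scal (V := C_NormedModule) (y ^ 2) _ _ (is_series_Cps p y Hp Hy1)).
  assert (S2 := is_series_scal (V := C_NormedModule) (- x ^ 2) _ _ (is_series_Cps p x Hp Hx)).
  assert (S3 := is_series_scal (V := C_NormedModule) (- ((y - x) * x)) _ _ (is_series_Cps d x Hd Hx)).
  assert (S4 := is_series_plus _ _ _ _ (is_series_plus _ _ _ _ S1 S2) S3).
  clear S1 S2 S3.
  replace (_ - _ - _) with
    (y ^ 2 * Cps p y + - x ^ 2 * Cps p x + - ((y - x) * x) * Cps d x).
  2:{ unfold PS_derive at 1, PS_decr_1; simpl; rewrite Rmult_1_l; ring. }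
  refine (is_series_ext _ _ _ _ S4).
  intros n; unfold e, p, d, PS_derive, PS_decr_1.
  change (y ^ 2 * (a (S (S n)) * y ^ n) + - x ^ 2 * (a (S (S n)) * x ^ n)
    + - ((y - x) * x) * ((INR (S (S n)) * a (S (S n)))%R * x ^ n) =
    a (S (S n)) * (y ^ S (S n) - x ^ S (S n) - INR (S (S n)) * x ^ S n * (y - x))).
  rewrite RtoC_mult !Cpow_S /=; ring. }
split; [apply is_linear_scal_l | ].
intros y0 Hy0 eps.
apply (is_filter_lim_locally_unique (K := C_AbsRing) (V := AbsRing_NormedModule C_AbsRing)) in Hy0.
subst y0.
(* The first bound keeps [y] in the disc of radius [rho], the second makes [Series b] times |y-x| at
   most [eps]; the [+ 1] guards against [Series b] being 0. *)
set (del := Rmin (rho - Cmod x) (eps / (Series b + 1))).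
assert (Hdel : (0 < del)%R).
{ apply Rmin_pos; [lra | ]. apply Rdiv_lt_0_compat; [apply cond_pos | lra]. }
exists (mkposreal del Hdel); intros y Hy.
change (Cmod (y - x) < del)%R in Hy.
change (Cmod (Cps a y - Cps a x - (y - x) * Cps (PS_derive a) x) <= eps * Cmod (y - x))%R.
assert (H1 : (del <= rho - Cmod x)%R) by apply Rmin_l.
assert (H2 : (del <= eps / (Series b + 1))%R) by apply Rmin_r.
eapply Rle_trans; [apply Hquad | ].
- replace y with (x + (y - x)) by ring.
  eapply Rle_trans; [apply Cmod_triangle | lra].
- assert (Hd := Cmod_ge_0 (y - x)).
  replace (Series b * _)%R with ((Series b * Cmod (y - x)) * Cmod (y - x))%R by (simpl; ring).
  apply Rmult_le_compat_r; trivial.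
  apply Rle_trans with ((Series b + 1) * (eps / (Series b + 1)))%R.
  + apply Rmult_le_compat; lra.
  + right; field; lra.
Qed.

Lemma continuous_Cps (a : nat -> R) (x : C) :
  Rbar_le 1 (CV_radius a) -> (Cmod x < 1)%R ->
  filterlim (Cps a) (@locally C_UniformSpace x) (@locally C_UniformSpace (Cps a x)).
Proof.
intros Ha Hx.
assert (H : @continuous (AbsRing_UniformSpace C_AbsRing) C_UniformSpace (Cps a) x).
{ apply (ex_derive_continuous (K := C_AbsRing) (V := C_NormedModule)).
  exists (Cps (PS_derive a) x); now apply is_derive_Cps. }
(* The modulus balls of [C_AbsRing] and the product balls of [C_UniformSpace] define the same
   neighbourhoods. *)
intros P HP; apply locally_C, (H P HP).
Qed.

Lemma filterlim_Re_Im (F : (nat -> Prop) -> Prop) {FF : Filter F} (f : nat -> C) (l : C) :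
  filterlim f F (@locally C_UniformSpace l) ->
  filterlim (fun n => Re (f n)) F (locally (Re l))
  /\ filterlim (fun n => Im (f n)) F (locally (Im l)).
Proof.
intros H; split; eapply filterlim_comp; try exact H.
- apply (continuous_fst (U := R_UniformSpace) (V := R_UniformSpace)).
- apply (continuous_snd (U := R_UniformSpace) (V := R_UniformSpace)).
Qed.

Lemma is_series_Re_Im (a : nat -> C) (l : C) :
  @is_series C_AbsRing C_NormedModule a l ->
  is_series (fun n => Re (a n)) (Re l) /\ is_series (fun n => Im (a n)) (Im l).
Proof.
intros H; destruct (filterlim_Re_Im eventually _ _ H) as [H1 H2].
split; [refine (filterlim_ext _ _ _ H1) | refine (filterlim_ext _ _ _ H2)];
  (intros n; induction n as [|n IH]; [now rewrite !sum_O | ]);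
  rewrite !sum_Sn -IH; reflexivity.
Qed.

(** * The exponential and the logarithm series *)

Lemma cexp_plus (x y : C) : cexp (x + y) = cexp x * cexp y.
Proof.
destruct x as [a b], y as [c d]; unfold cexp, Cplus, Cmult; simpl.
rewrite exp_plus cos_plus sin_plus; f_equal; ring.
Qed.

Lemma cexp_0 : cexp 0 = 1.
Proof.
unfold cexp; simpl; rewrite exp_0 cos_0 sin_0 Rmult_1_l Rmult_0_r; reflexivity.
Qed.

Lemma cexp_opp_l (x : C) : cexp (- x) * cexp x = 1.
Proof. rewrite -cexp_plus -cexp_0; f_equal; ring. Qed.

Lemma cexp_neq_0 (x : C) : cexp x <> 0.
Proof.
intros H; assert (H1 := cexp_opp_l x); rewrite H Cmult_0_r in H1.
now apply C1_nz.
Qed.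

Lemma cexp_opp (x : C) : cexp (- x) = / cexp x.
Proof.
assert (H := cexp_neq_0 x).
rewrite -(Cmult_1_l (/ cexp x)) -(cexp_opp_l x); field; exact H.
Qed.

Lemma Cmod_cexp (x : C) : Cmod (cexp x) = exp (Re x).
Proof.
unfold Cmod, cexp; simpl.
rewrite -[X in _ = X]sqrt_Rsqr; [ | left; apply exp_pos].
f_equal; unfold Rsqr.
assert (H := sin2_cos2 (Im x)); unfold Rsqr in H.
transitivity (exp (Re x) * exp (Re x) * (sin (Im x) * sin (Im x) + cos (Im x) * cos (Im x)))%R.
- ring.
- rewrite H; ring.
Qed.

(** The modulus of [cexp d] gives Re d = 0; then sin (Im d) = 0 with |Im d| < 1 < PI forces Im d =
    0. Radius 1 is far from the optimal 2 PI but enough for a local argument. *)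
Lemma cexp_eq_1_small (d : C) : cexp d = 1 -> (Cmod d < 1)%R -> d = 0.
Proof.
intros H Hd.
assert (HRe : Re d = 0%R).
{ apply exp_inv; rewrite exp_0 -Cmod_cexp H; apply Cmod_1. }
assert (HIm : (Im d < 1 /\ -1 < Im d)%R).
{ apply Rabs_def2.
  eapply Rle_lt_trans; [ | exact Hd].
  eapply Rle_trans; [apply Rmax_r | apply Rmax_Cmod]. }
assert (Hs : sin (Im d) = 0%R).
{ assert (H' := f_equal Im H); unfold cexp in H'; simpl in H'.
  rewrite HRe exp_0 in H'; lra. }
assert (HPI := PI2_1).
destruct (Rtotal_order (Im d) 0) as [Hlt | [Heq | Hgt]].
- assert (sin (Im d) < 0)%R by (apply sin_lt_0_var; lra); lra.
- destruct d as [d1 d2]; simpl in *; subst; reflexivity.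
- assert (0 < sin (Im d))%R by (apply sin_gt_0; lra); lra.
Qed.

Lemma continuous_cexp (x : C) :
  filterlim cexp (@locally C_UniformSpace x) (@locally C_UniformSpace (cexp x)).
Proof.
assert (HRe : @continuous C_UniformSpace R_UniformSpace Re x)
  by apply (continuous_fst (U := R_UniformSpace) (V := R_UniformSpace)).
assert (HIm : @continuous C_UniformSpace R_UniformSpace Im x)
  by apply (continuous_snd (U := R_UniformSpace) (V := R_UniformSpace)).
assert (He : @continuous C_UniformSpace R_UniformSpace (fun x => exp (Re x)) x).
{ apply (continuous_comp (U := C_UniformSpace) Re exp); trivial.
  apply (ex_derive_continuous (K := R_AbsRing) (V := R_NormedModule) exp); auto_derive; trivial. }
apply (continuous_comp_2 (U := C_UniformSpace) (V := R_UniformSpace) (W := R_UniformSpace)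
  (X := C_UniformSpace) (fun x : C => (exp (Re x) * cos (Im x))%R)
  (fun x : C => (exp (Re x) * sin (Im x))%R) pair).
3:{ apply continuous_ext with (fun z => z); [now intros [] | apply continuous_id]. }
- apply (continuous_mult (U := C_UniformSpace) (K := R_AbsRing)); trivial.
  apply (continuous_comp (U := C_UniformSpace) Im cos); trivial.
  apply (ex_derive_continuous (K := R_AbsRing) (V := R_NormedModule) cos); auto_derive; trivial.
- apply (continuous_mult (U := C_UniformSpace) (K := R_AbsRing)); trivial.
  apply (continuous_comp (U := C_UniformSpace) Im sin); trivial.
  apply (ex_derive_continuous (K := R_AbsRing) (V := R_NormedModule) sin); auto_derive; trivial.
Qed.

Lemma Cminus_1_neq_0 (x : C) : (Cmod x < 1)%R -> 1 - x <> 0.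
Proof.
intros Hx H; replace x with (RtoC 1) in Hx.
- rewrite Cmod_1 in Hx; lra.
- replace x with (1 - (1 - x)) by ring; rewrite H; ring.
Qed.

Lemma CV_radius_ones : Rbar_le 1 (CV_radius (fun _ => 1%R)).
Proof. apply CV_radius_ge_1 with 1%R; intros n; rewrite Rabs_R1; lra. Qed.

(** A constant coefficient sequence is its own shift, so the sum S satisfies S = 1 + x S. *)
Lemma Cps_geom (x : C) : (Cmod x < 1)%R -> Cps (fun _ => 1%R) x = / (1 - x).
Proof.
intros Hx.
assert (H1 := Cminus_1_neq_0 x Hx).
assert (E := Cps_decr_1 _ x CV_radius_ones Hx).
change (PS_decr_1 (fun _ => 1%R)) with (fun _ : nat => 1%R) in E.
assert (E' : Cps (fun _ => 1%R) x * (1 - x) = 1).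
{ transitivity (Cps (fun _ => 1%R) x - x * Cps (fun _ => 1%R) x); [ring | ].
  rewrite {1}E; ring. }
transitivity (Cps (fun _ => 1%R) x * (1 - x) / (1 - x)); [ | rewrite E']; field; exact H1.
Qed.

(* Coefficients of [- log (1 - x)]; the junk value [/ 0 = 0] is the right one at [n = 0]. *)
Definition PS_log (n : nat) : R := / INR n.

Lemma PS_log_bounds (n : nat) : (0 <= PS_log n <= 1)%R.
Proof.
destruct n as [|n]; unfold PS_log.
- simpl; rewrite Rinv_0; lra.
- assert (H : (1 <= INR (S n))%R) by (rewrite S_INR; assert (H := pos_INR n); lra).
  split.
  + left; apply Rinv_0_lt_compat; lra.
  + rewrite -Rinv_1; apply Rinv_le_contravar; lra.
Qed.

Lemma CV_radius_log : Rbar_le 1 (CV_radius PS_log).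
Proof.
apply CV_radius_ge_1 with 1%R; intros n.
rewrite Rabs_pos_eq; apply PS_log_bounds.
Qed.

(* [p] is [Re] or [Im]: along the ray through [y] both are real power series in the
   parameter, so termwise differentiation of real power series applies. *)
Lemma is_derive_Cps_log_ray (p : C -> R)
  (p_scal : forall (r : R) (z : C), p (r * z) = (r * p z)%R)
  (p_le : forall z : C, (Rabs (p z) <= Cmod z)%R)
  (p_series : forall (a : nat -> C) (l : C),
    @is_series C_AbsRing C_NormedModule a l -> is_series (fun n => p (a n)) (p l))
  (y : C) (t : R) :
  (Cmod y < 1)%R ->
  (0 <= t <= 1)%R ->
  is_derive (fun s : R => p (Cps PS_log (s * y))) t (p (y / (1 - t * y))).
Proof.
intros Hy Ht; assert (Hy0 := Cmod_ge_0 y).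
assert (Hsy : forall s : R, Cmod (s * y) = (Rabs s * Cmod y)%R).
{ intros s; now rewrite Cmod_mult Cmod_R. }
set (b := fun n => (PS_log n * p (y ^ n)%C)%R).
(* Chosen so that r > 1 and r |y| <= 1: the real series in the parameter then has radius at least
   [r], and the endpoint t = 1 is interior. *)
set (r := (2 / (1 + Cmod y))%R).
assert (Hr : (1 < r)%R).
{ unfold r; apply Rmult_lt_reg_r with (1 + Cmod y)%R; [lra | ].
  unfold Rdiv; rewrite Rmult_assoc Rinv_l; lra. }
assert (Hry : (r * Cmod y <= 1)%R).
{ unfold r; apply Rmult_le_reg_r with (1 + Cmod y)%R; [lra | ].
  replace (2 / (1 + Cmod y) * Cmod y * (1 + Cmod y))%R with (2 * Cmod y)%R by (field; lra).
  lra. }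
assert (Hb : Rbar_le r (CV_radius b)).
{ apply (proj1 (CV_radius_bounded b)); exists 1%R; intros n.
  unfold b; rewrite !Rabs_mult (Rabs_pos_eq (PS_log n)); [ | apply PS_log_bounds].
  rewrite (Rabs_pos_eq (r ^ n)); [ | apply pow_le; lra].
  rewrite Rmult_assoc -(Rmult_1_l 1).
  apply Rmult_le_compat; try apply PS_log_bounds.
  - apply Rmult_le_pos; [apply Rabs_pos | apply pow_le; lra].
  - apply Rle_trans with ((r * Cmod y) ^ n)%R.
    + rewrite Rpow_mult_distr Rmult_comm; apply Rmult_le_compat_l; [apply pow_le; lra | ].
      rewrite -Cmod_pow; apply p_le.
    + rewrite -(pow1 n); apply pow_incr; split; trivial.
      apply Rmult_le_pos; lra. }
assert (Hbt : forall s : R, (Rabs s < r)%R -> p (Cps PS_log (s * y)) = PSeries b s).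
{ intros s Hs; symmetry; apply is_pseries_unique, is_pseries_R.
  refine (is_series_ext _ _ _ _ (p_series _ _ (is_series_Cps PS_log (s * y) CV_radius_log _))).
  - intros n; rewrite Cpow_mult_l -RtoC_pow.
    rewrite !p_scal; unfold b.
    change (PS_log n * (s ^ n * p (y ^ n)%C) = PS_log n * p (y ^ n)%C * s ^ n)%R; ring.
  - rewrite Hsy; destruct (Req_dec (Cmod y) 0) as [H0 | H0]; [rewrite H0; lra | ].
    eapply Rlt_le_trans; [ | exact Hry].
    apply Rmult_lt_compat_r; lra. }
assert (Ht1 : (Cmod (t * y) < 1)%R) by (rewrite Hsy Rabs_pos_eq; nra).
(* Differentiation cancels the 1/n, leaving [y] times the geometric series at t y. *)
assert (Hd : PSeries (PS_derive b) t = p (y / (1 - t * y))).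
{ apply is_pseries_unique, is_pseries_R.
  assert (Hs := is_series_scal (V := C_NormedModule) y _ _
    (is_series_Cps _ _ CV_radius_ones Ht1)).
  rewrite Cps_geom in Hs; trivial.
  refine (is_series_ext _ _ _ _ (p_series _ _ Hs)).
  intros n; unfold PS_derive, b, PS_log.
  change (p (y * (1 * (t * y) ^ n))%C = INR (S n) * (/ INR (S n) * p (y ^ S n)%C) * t ^ n)%R.
  replace (y * (1 * (t * y) ^ n)) with ((t ^ n)%R * y ^ S n).
  - rewrite p_scal; field; apply not_0_INR; discriminate.
  - rewrite Cpow_mult_l RtoC_pow Cpow_S; ring. }
rewrite -Hd.
apply is_derive_ext_loc with (PSeries b).
2:{ apply is_derive_PSeries, Rbar_lt_le_trans with r; trivial.
    rewrite Rabs_pos_eq; simpl; lra. }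
(* Since t lies in [0, 1], a ball of radius r - 1 around it stays inside |s| < r, where [Hbt]
   holds. *)
exists (mkposreal (r - 1) ltac:(lra)); intros s Hs.
symmetry; apply Hbt.
change (Rabs (s - t) < r - 1)%R in Hs.
replace s with (t + (s - t))%R by ring.
eapply Rle_lt_trans; [apply Rabs_triang | rewrite (Rabs_pos_eq t); lra].
Qed.
(** Along t in [0, 1], the product of 1 - t y and the exponential of the logarithm series at t y has
    zero derivative and equals 1 at t = 0. As [cexp] is defined by its two parts, the
    differentiation is done on real functions of t. *)
Lemma cexp_Cps_log (y : C) :
  (Cmod y < 1)%R -> cexp (- Cps PS_log y) = 1 - y.
Proof.
intros Hy.
assert (HRe : forall t : R, (0 <= t <= 1)%R ->
  is_derive (fun s : R => Re (Cps PS_log (s * y))) t (Re (y / (1 - t * y)))).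
{ intros t Ht; apply is_derive_Cps_log_ray; trivial.
  - intros r [c d]; simpl; ring.
  - apply re_le_Cmod.
  - intros a l H; apply (proj1 (is_series_Re_Im a l H)). }
assert (HIm : forall t : R, (0 <= t <= 1)%R ->
  is_derive (fun s : R => Im (Cps PS_log (s * y))) t (Im (y / (1 - t * y)))).
{ intros t Ht; apply is_derive_Cps_log_ray; trivial.
  - intros r [c d]; simpl; ring.
  - intros z; eapply Rle_trans; [apply Rmax_r | apply Rmax_Cmod].
  - intros a l H; apply (proj2 (is_series_Re_Im a l H)). }
(* This is |1 - t y|^2, the denominator of both parts of y / (1 - t y). *)
assert (Hn : forall t : R, (0 <= t <= 1)%R -> ((1 - t * Re y) ^ 2 + (t * Im y) ^ 2 <> 0)%R).
{ intros t Ht.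
  assert (Hc := re_le_Cmod y); apply Rabs_le_between in Hc.
  assert (0 < 1 - t * Re y)%R by nra.
  nra. }
set (al := fun s : R => Re (Cps PS_log (s * y))) in *.
set (be := fun s : R => Im (Cps PS_log (s * y))) in *.
assert (H0 : Cps PS_log 0 = 0).
{ rewrite Cps_decr_1; [ | apply CV_radius_log | rewrite Cmod_0; lra].
  unfold PS_log at 1; simpl; rewrite Rinv_0; ring. }
assert (Hal : forall t : R, (0 <= t <= 1)%R -> is_derive al t
  ((Re y * (1 - t * Re y) - t * Im y * Im y) / ((1 - t * Re y) ^ 2 + (t * Im y) ^ 2))%R).
{ intros t Ht; specialize (Hn t Ht).
  replace (_ / _)%R with (Re (y / (1 - t * y))); [now apply HRe | ].
  destruct y as [c d]; simpl in *; field_simplify; trivial; try (f_equal; ring).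
  all: intros HH; apply Hn; ring_simplify in HH; ring_simplify; exact HH. }
assert (Hbe : forall t : R, (0 <= t <= 1)%R -> is_derive be t
  (Im y / ((1 - t * Re y) ^ 2 + (t * Im y) ^ 2))%R).
{ intros t Ht; specialize (Hn t Ht).
  replace (_ / _)%R with (Im (y / (1 - t * y))); [now apply HIm | ].
  destruct y as [c d]; simpl in *; field_simplify; trivial; try (f_equal; ring).
  all: intros HH; apply Hn; ring_simplify in HH; ring_simplify; exact HH. }

assert (Hal0 : al 0%R = 0%R) by (unfold al; rewrite Cmult_0_l H0; reflexivity).
assert (Hbe0 : be 0%R = 0%R) by (unfold be; rewrite Cmult_0_l H0; reflexivity).
assert (Hab1 : Cps PS_log y = (al 1%R, be 1%R)).
{ unfold al, be; rewrite Cmult_1_l; apply surjective_pairing. }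
(* From here on only the derivatives, the values at 0 and the link with [Cps PS_log y] at 1
   matter. *)
clearbody al be.
assert (Eal : forall t : R, (0 <= t <= 1)%R -> ex_derive (fun x => al x) t)
  by (intros t Ht; eexists; exact (Hal t Ht)).
assert (Ebe : forall t : R, (0 <= t <= 1)%R -> ex_derive (fun x => be x) t)
  by (intros t Ht; eexists; exact (Hbe t Ht)).
(* Real and imaginary parts of [(1 - t y) * cexp (Cps PS_log (t y))], constant in [t]. *)
set (gr := fun t : R => (exp (al t) * ((1 - t * Re y) * cos (be t) + t * Im y * sin (be t)))%R).
set (gi := fun t : R => (exp (al t) * ((1 - t * Re y) * sin (be t) - t * Im y * cos (be t)))%R).
assert (Hgr : gr 0%R = gr 1%R).
{ apply eq_is_derive; [ | lra]; intros t Ht; specialize (Hn t Ht).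
  unfold gr; auto_derive.
  - repeat split; auto.
  - rewrite (is_derive_unique (fun x => al x) _ _ (Hal t Ht)).
    rewrite (is_derive_unique (fun x => be x) _ _ (Hbe t Ht)).
    change (@zero _) with 0%R; field; exact Hn. }
assert (Hgi : gi 0%R = gi 1%R).
{ apply eq_is_derive; [ | lra]; intros t Ht; specialize (Hn t Ht).
  unfold gi; auto_derive.
  - repeat split; auto.
  - rewrite (is_derive_unique (fun x => al x) _ _ (Hal t Ht)).
    rewrite (is_derive_unique (fun x => be x) _ _ (Hbe t Ht)).
    change (@zero _) with 0%R; field; exact Hn. }
unfold gr, gi in Hgr, Hgi; rewrite Hal0 Hbe0 exp_0 cos_0 sin_0 in Hgr Hgi.
assert (E : (1 - y) * cexp (Cps PS_log y) = 1).
{ rewrite Hab1; unfold cexp; destruct y as [c d]; simpl in *.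
  unfold Cmult, Cminus, Cplus, Copp, RtoC; simpl; f_equal; lra. }
rewrite cexp_opp.
transitivity ((1 - y) * cexp (Cps PS_log y) / cexp (Cps PS_log y)).
- rewrite E; field; apply cexp_neq_0.
- field; apply cexp_neq_0.
Qed.

(** * The q-Pochhammer symbol and [A_q] *)

(* Here too [/ 0 = 0] gives the constant coefficient [0]. *)
Definition PS_psi (q : R) (n : nat) : R := / (INR n * (1 - q ^ n)).

Lemma pow_lt_1_S (q : R) (n : nat) : (0 < q < 1)%R -> (0 < q ^ S n <= q)%R.
Proof.
intros Hq; split; [apply pow_lt; lra | ].
assert (H : (q ^ n <= 1)%R) by (rewrite -(pow1 n); apply pow_incr; lra).
simpl; nra.
Qed.

Lemma PS_euler_euler_psi (q : R) (n : nat) :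
  (0 < q < 1)%R -> PS_euler (PS_euler (PS_psi q)) n = (INR n / (1 - q ^ n))%R.
Proof.
intros Hq; unfold PS_euler, PS_psi; destruct n as [|n].
- simpl; unfold Rdiv; ring.
- assert (H := pow_lt_1_S q n Hq); field; split; [lra | ].
  apply not_0_INR; discriminate.
Qed.

(** One Euler derivative leaves the radius unchanged and turns the coefficients into 1/(1 - q^n),
    which are bounded by 1/(1 - q). *)
Lemma CV_radius_psi (q : R) : (0 < q < 1)%R -> Rbar_le 1 (CV_radius (PS_psi q)).
Proof.
intros Hq.
rewrite -CV_radius_euler; apply CV_radius_ge_1 with (/ (1 - q))%R; intros [|n].
- unfold PS_euler; simpl; rewrite Rmult_0_l Rabs_R0.
  left; apply Rinv_0_lt_compat; lra.
- assert (H := pow_lt_1_S q n Hq).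
  replace (PS_euler (PS_psi q) (S n)) with (/ (1 - q ^ S n))%R.
  + rewrite Rabs_pos_eq; [apply Rinv_le_contravar; lra | ].
    left; apply Rinv_0_lt_compat; lra.
  + unfold PS_euler, PS_psi; field; split; [lra | apply not_0_INR; discriminate].
Qed.

Definition psi (q : R) : C -> C := Cps (PS_psi q).

Lemma psi_0 (q : R) : (0 < q < 1)%R -> psi q 0 = 0.
Proof.
intros Hq; unfold psi; rewrite Cps_decr_1; [ | now apply CV_radius_psi | rewrite Cmod_0; lra].
unfold PS_psi at 1; simpl; rewrite Rmult_0_l Rinv_0; ring.
Qed.

Lemma Cmod_scal_lt_1 (q : R) (x : C) :
  (0 <= q <= 1)%R -> (Cmod x < 1)%R -> (Cmod (q * x) < 1)%R.
Proof.
intros Hq Hx; rewrite Cmod_mult Cmod_R Rabs_pos_eq; [ | lra].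
assert (H := Cmod_ge_0 x); nra.
Qed.

(** Coefficientwise, (1 - q^n) / (n (1 - q^n)) = 1/n; degree 0 is separate and holds because all
    three coefficients are 0. *)
Lemma psi_shift (q : R) (x : C) :
  (0 < q < 1)%R -> (Cmod x < 1)%R -> psi q x = Cps PS_log x + psi q (q * x).
Proof.
intros Hq Hx; assert (H := CV_radius_psi q Hq).
assert (Hqx := Cmod_scal_lt_1 q x ltac:(lra) Hx).
unfold psi, Cps.
rewrite -Cseries_plus; try now apply ex_series_Cps; trivial.
2:{ apply ex_series_Cps; trivial; apply CV_radius_log. }
apply Cseries_ext.
2:{ apply: (ex_series_plus (V := C_NormedModule)); apply ex_series_Cps; trivial; apply CV_radius_log. }
intros n; rewrite Cpow_mult_l -RtoC_pow Cmult_assoc -RtoC_mult -Cmult_plus_distr_r -RtoC_plus.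
do 2 f_equal; unfold PS_psi, PS_log; destruct n as [|n].
- simpl; rewrite Rmult_0_l Rinv_0; ring.
- assert (Hn := pow_lt_1_S q n Hq); field; split; [lra | ].
  apply not_0_INR; discriminate.
Qed.

(** By [psi_shift], the factor 1 - q^n x is the exponential of psi(q^(n+1) x) - psi(q^n x). *)
Lemma Cprod_qpoch (q : R) (x : C) (n : nat) :
  (0 < q < 1)%R -> (Cmod x < 1)%R ->
  Cprod (fun k => 1 - x * RtoC q ^ k) n = cexp (- psi q x) * cexp (psi q ((q ^ n)%R * x)).
Proof.
intros Hq Hx; induction n as [|n IH].
- simpl; rewrite Cmult_1_l cexp_opp_l; reflexivity.
- assert (Hn : (Cmod ((q ^ n)%R * x) < 1)%R).
  { apply Cmod_scal_lt_1; trivial; split; [apply pow_le; lra | ].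
    rewrite -(pow1 n); apply pow_incr; lra. }
  simpl Cprod; rewrite IH (psi_shift q ((q ^ n)%R * x)) //.
  rewrite -RtoC_pow (Cmult_comm x) -cexp_Cps_log // cexp_plus.
  replace (RtoC (q ^ S n)%R * x) with (q * ((q ^ n)%R * x)) by (simpl; rewrite RtoC_mult; ring).
  transitivity (cexp (- psi q x) * cexp (psi q (q * ((q ^ n)%R * x)))
    * (cexp (- Cps PS_log ((q ^ n)%R * x)) * cexp (Cps PS_log ((q ^ n)%R * x)))); [ring | ].
  rewrite cexp_opp_l; ring.
Qed.

(** In the finite product the second factor tends to [cexp (psi q 0)], which is 1, as q^n x tends to
    0. Exhibiting the limit also settles that the [iota] in [qpoch] is meaningful. *)
Lemma qpoch_cexp (q : R) (x : C) :
  (0 < q < 1)%R -> (Cmod x < 1)%R -> qpoch x q = cexp (- psi q x).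
Proof.
intros Hq Hx.
apply (iota_filterlim_locally (K := C_AbsRing) (V := C_CompleteNormedModule)
  (F := eventually) (Cprod (fun k => 1 - x * RtoC q ^ k)) (cexp (- psi q x))).
apply filterlim_ext with
  (fun n => cexp (- psi q x) * cexp (psi q ((q ^ n)%R * x))).
{ intros n; symmetry; now apply Cprod_qpoch. }
enough (Hlim : filterlim (fun n => cexp (- psi q x) * cexp (psi q ((q ^ n)%R * x))) eventually
  (@locally C_UniformSpace (cexp (- psi q x) * cexp (psi q 0)))).
{ rewrite psi_0 // cexp_0 Cmult_1_r in Hlim; exact Hlim. }
apply (filterlim_comp _ _ _ (fun n => cexp (psi q ((q ^ n)%R * x))) (fun y => cexp (- psi q x) * y)
  eventually (@locally C_UniformSpace (cexp (psi q 0)))).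
2:{ exact (@filterlim_scal_r C_AbsRing C_NormedModule (cexp (- psi q x)) (cexp (psi q 0))). }
apply (filterlim_comp _ _ _ (fun n => psi q ((q ^ n)%R * x)) cexp
  eventually (@locally C_UniformSpace (psi q 0))); [ | apply continuous_cexp].
apply (filterlim_comp _ _ _ (fun n => (q ^ n)%R * x) (psi q)
  eventually (@locally C_UniformSpace (RtoC 0))).
2:{ apply continuous_Cps; [now apply CV_radius_psi | rewrite Cmod_0; lra]. }
assert (Hg : filterlim (fun n => (q ^ n)%R) eventually (locally 0%R)).
{ apply (is_lim_seq_geom q); rewrite Rabs_pos_eq; lra. }
intros P HP; apply locally_C in HP; destruct HP as [eps HP].
(* Dividing by |x| + 1 instead of |x| covers x = 0. *)
assert (He : (0 < eps / (Cmod x + 1))%R).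
{ apply Rdiv_lt_0_compat; [apply cond_pos | ]. assert (H := Cmod_ge_0 x); lra. }
destruct (Hg _ (locally_ball 0%R (mkposreal _ He))) as [N HN].
exists N; intros n Hn; apply HP.
specialize (HN n Hn); change (Rabs (q ^ n - 0) < eps / (Cmod x + 1))%R in HN.
change (Cmod ((q ^ n)%R * x - 0) < eps)%R.
rewrite Rminus_0_r in HN.
replace ((q ^ n)%R * x - 0) with ((q ^ n)%R * x) by ring; rewrite Cmod_mult Cmod_R.
assert (H := Cmod_ge_0 x).
apply Rle_lt_trans with (Rabs (q ^ n) * (Cmod x + 1))%R.
- apply Rmult_le_compat_l; [apply Rabs_pos | lra].
- apply Rmult_lt_reg_r with (/ (Cmod x + 1))%R; [apply Rinv_0_lt_compat; lra | ].
  rewrite Rmult_assoc Rinv_r; [ | lra]; rewrite Rmult_1_r; exact HN.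
Qed.

(** * Branches of logarithms near a point, and A_q as a power series *)

Lemma locally_Cmod (x : C) (P : C -> Prop) (e : R) :
  (0 < e)%R -> (forall y, (Cmod (y - x) < e)%R -> P y) -> @locally C_UniformSpace x P.
Proof. intros He H; apply locally_C; exists (mkposreal e He); exact H. Qed.

Lemma locally_Cmod_lt (x : C) (r : R) :
  (Cmod x < r)%R -> @locally C_UniformSpace x (fun y => (Cmod y < r)%R).
Proof.
intros H; apply (locally_Cmod _ _ (r - Cmod x)); [lra | ].
intros y Hy; replace y with (x + (y - x)) by ring.
eapply Rle_lt_trans; [apply Cmod_triangle | lra].
Qed.

Lemma is_derive_C_ext_loc (f g : C -> C) (x d : C) :
  @locally C_UniformSpace x (fun y => f y = g y) ->
  @is_derive C_AbsRing C_NormedModule g x d ->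
  @is_derive C_AbsRing C_NormedModule f x d.
Proof.
intros H; apply is_derive_ext_loc; apply locally_C.
revert H; apply filter_imp; intros y Hy; now symmetry.
Qed.

(** The increments of [L] and [M] from [p] have equal exponentials and, by continuity, are each
    below 1/2 near [p]. Their difference has modulus below 1, so [cexp_eq_1_small] makes it 0. *)
Lemma logs_differ_by_const {T : UniformSpace} (L M : T -> C) (p : T) :
  continuous (U := C_UniformSpace) L p -> continuous (U := C_UniformSpace) M p ->
  locally p (fun r => cexp (L r) = cexp (M r)) ->
  locally p (fun r => L r = M r + (L p - M p)).
Proof.
intros HL HM He.
assert (Hp := locally_singleton _ _ He); simpl in Hp.
assert (HB : forall f : T -> C, continuous (U := C_UniformSpace) f p ->
  locally p (fun r => (Cmod (f r - f p) < 1 / 2)%R)).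
{ intros f Hf; apply (Hf (fun y => (Cmod (y - f p) < 1 / 2)%R)).
  apply (locally_Cmod _ _ (1 / 2)); [lra | trivial]. }
generalize (filter_and _ _ He (filter_and _ _ (HB L HL) (HB M HM))).
apply filter_imp; intros r (Hr & Hr1 & Hr2).
assert (Hd : (L r - L p) + - (M r - M p) = 0).
{ apply cexp_eq_1_small.
  - replace ((L r - L p) + - (M r - M p)) with ((L r + - M r) + - (L p + - M p)) by ring.
    rewrite cexp_plus cexp_opp !cexp_plus !cexp_opp Hr Hp; field; split; apply cexp_neq_0.
  - eapply Rle_lt_trans; [apply Cmod_triangle | rewrite Cmod_opp; lra]. }
replace (L r) with ((L r - L p + - (M r - M p)) + (M r + (L p - M p))) by ring.
rewrite Hd; ring.
Qed.

(** Two Euler derivatives of [psi] have coefficients n/(1 - q^n). The series of A_q starts at index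
    1, which matches because the coefficient in degree 0 is 0. *)
Lemma is_series_A_term (q : R) (x : C) :
  (0 < q < 1)%R -> (Cmod x < 1)%R ->
  @is_series C_AbsRing C_NormedModule (fun n => A_term q x (S n))
    (Cps (PS_euler (PS_euler (PS_psi q))) x).
Proof.
intros Hq Hx.
set (a := PS_euler (PS_euler (PS_psi q))).
assert (Ha : Rbar_le 1 (CV_radius a)).
{ unfold a; rewrite !CV_radius_euler; now apply CV_radius_psi. }
apply is_series_ext with (fun n => RtoC (a (S n)) * x ^ S n).
- intros n; unfold a; rewrite PS_euler_euler_psi //.
  assert (Hn := pow_lt_1_S q n Hq).
  unfold A_term, Rdiv.
  rewrite RtoC_mult RtoC_inv; [ | lra].
  rewrite RtoC_minus RtoC_pow; unfold Cdiv.
  change (@eq C (INR (S n) * / (1 - q ^ S n) * x ^ S n) (INR (S n) * x ^ S n * / (1 - q ^ S n))).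
  ring.
- apply (is_series_incr_1 (V := C_NormedModule) (fun n => RtoC (a n) * x ^ n)).
  replace (plus _ _) with (Cps a x); [now apply is_series_Cps | ].
  unfold a at 3; unfold PS_euler at 1; simpl; rewrite Rmult_0_l.
  change (@eq C (Cps a x) (Cps a x + 0 * 1)); ring.
Qed.

Lemma Aq_Cps (q : R) (x : C) :
  (0 < q < 1)%R -> (Cmod x < 1)%R ->
  Aq q x = Cps (PS_euler (PS_euler (PS_psi q))) x.
Proof. intros Hq Hx; now apply is_Cseries_unique, is_series_A_term. Qed.

(** Summability forces the terms to 0, whereas for |x| >= 1 the r-th term has modulus at least r/(1
    - q^r) >= 1. *)
Lemma A_normal_Cmod_lt {T : Type} (D : T -> Prop) (q : R) (x : T -> C) (p : T) :
  (0 < q < 1)%R -> A_normal D q x -> D p -> (Cmod (x p) < 1)%R.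
Proof.
intros Hq (M & HM & Hle) Hp.
destruct (Rlt_or_le (Cmod (x p)) 1) as [H | H]; trivial; exfalso.
assert (H0 := ex_series_lim_0 M HM).
apply is_lim_seq_spec in H0.
destruct (H0 (mkposreal 1 Rlt_0_1)) as [N HN].
specialize (HN N (le_n N)); simpl in HN.
specialize (Hle N p Hp).
assert (Hn := pow_lt_1_S q N Hq).
assert (H1 : (1 <= Cmod (A_term q (x p) (S N)))%R).
{ unfold A_term; rewrite -RtoC_pow -RtoC_minus Cmod_div.
  2:{ intros E; apply RtoC_inj in E; lra. }
  rewrite Cmod_mult Cmod_pow !Cmod_R (Rabs_pos_eq (INR _)); [ | apply pos_INR].
  rewrite Rabs_pos_eq; [ | lra].
  assert (Hx : (1 <= Cmod (x p) ^ S N)%R) by now apply pow_R1_Rle.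
  assert (HI : (1 <= INR (S N))%R) by (rewrite S_INR; assert (K := pos_INR N); lra).
  apply Rmult_le_reg_r with (1 - q ^ S N)%R; [lra | ].
  unfold Rdiv; rewrite Rmult_assoc Rinv_l; [ | lra]; nra. }
rewrite Rminus_0_r in HN; apply Rabs_def2 in HN; lra.
Qed.

Lemma qpoch_log_second_euler (q : R) (U : C -> Prop) (l : C -> C) (x : C) :
  (0 < q < 1)%R -> @open C_UniformSpace U ->
  @log_branch C_UniformSpace U (fun x => qpoch x q) l ->
  U x -> (Cmod x < 1)%R ->
  @locally C_UniformSpace x (C_ex_derive (fun y => - l y))
  /\ C_ex_derive (euler (fun y => - l y)) x
  /\ Aq q x = euler (euler (fun y => - l y)) x.
Proof.
intros Hq HU Hl Ux Hx.
assert (Hr := CV_radius_psi q Hq).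
assert (Hloc : @locally C_UniformSpace x (fun y => l y = - psi q y + (l x - - psi q x))).
{ apply (logs_differ_by_const (T := C_UniformSpace) l (fun y => - psi q y)).
  - apply (Hl x Ux).
  - apply (continuous_opp (U := C_UniformSpace) (V := C_NormedModule)).
    apply continuous_Cps; trivial.
  - generalize (filter_and _ _ (HU x Ux) (locally_Cmod_lt x 1 Hx)).
    apply filter_imp; intros y [Uy Hy].
    rewrite -qpoch_cexp //; apply (Hl y Uy). }
set (c := l x - - psi q x) in Hloc.
(* The first derivative must be known on a whole neighbourhood, since [euler] is applied to it
   again; hence [locally_locally]. *)
assert (Hd : @locally C_UniformSpace x (fun y => (Cmod y < 1)%R /\
  @is_derive C_AbsRing C_NormedModule (fun y => - l y) y (Cps (PS_derive (PS_psi q)) y))).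
{ generalize (filter_and _ _ (locally_locally _ _ Hloc) (locally_Cmod_lt x 1 Hx)).
  apply filter_imp; intros y [Hy1 Hy2]; split; trivial.
  apply is_derive_C_ext_loc with (fun y => psi q y + - c).
  - revert Hy1; apply filter_imp; intros t Ht; rewrite Ht; ring.
  - replace (Cps _ y) with (Cps (PS_derive (PS_psi q)) y + 0) by ring.
    apply: (is_derive_plus (V := C_NormedModule)).
    + now apply is_derive_Cps.
    + apply: (is_derive_const (V := C_NormedModule)). }
assert (He : @locally C_UniformSpace x (fun y =>
  euler (fun y => - l y) y = Cps (PS_euler (PS_psi q)) y)).
{ revert Hd; apply filter_imp; intros y [Hy Hdy]; unfold euler.
  rewrite (is_C_derive_unique _ _ _ Hdy) Cps_euler //. }
assert (Hr1 : Rbar_le 1 (CV_radius (PS_euler (PS_psi q)))) by now rewrite CV_radius_euler.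
assert (H2 := is_derive_C_ext_loc _ _ _ _ He (is_derive_Cps _ x Hr1 Hx)).
split; [ | split].
- revert Hd; apply filter_imp; intros y [_ Hdy]; eexists; exact Hdy.
- eexists; exact H2.
- unfold euler at 1; rewrite (is_C_derive_unique _ _ _ H2) Aq_Cps // Cps_euler //.
Qed.

(** * Decomposition of the kernel *)

(** The common form of all the sums defining a_r, b_r and c_r; [r] positive ensures t^r < 1. *)
Lemma Rseries1_geom_pow (f : nat -> R) (c t : R) (r : nat) :
  (0 < t < 1)%R -> (0 < r)%nat -> (forall k, f (S k) = (c * t ^ k)%R) ->
  Rseries1 (fun k => f k ^ r)%R = (c ^ r / (1 - t ^ r))%R.
Proof.
intros Ht Hr Hf; unfold Rseries1.
rewrite (Series_ext _ (fun k => c ^ r * (t ^ r) ^ k)%R).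
2:{ intros k; rewrite Hf Rpow_mult_distr -!pow_mult Nat.mul_comm //. }
rewrite Series_scal_l (is_series_unique _ _ (is_series_geom (t ^ r) _)) //.
destruct r as [|r]; [lia | ].
assert (H := pow_lt_1_S t r Ht); rewrite Rabs_pos_eq; lra.
Qed.

Lemma qq_bounds (u v : R) : (0 < u < 1)%R -> (0 < v < 1)%R -> (0 < qq u v < 1)%R.
Proof.
intros Hu Hv; unfold qq.
assert (Hu2 := pow_lt_1_S u 1 Hu); assert (Hv2 := pow_lt_1_S v 1 Hv); nra.
Qed.

Lemma pow_4_qq (u v : R) (k : nat) : (u ^ (4 * k) * v ^ (4 * k) = (qq u v ^ 2) ^ k)%R.
Proof. rewrite !pow_mult -Rpow_mult_distr; f_equal; unfold qq; ring. Qed.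

(** With Q = q^r this is (1 + Q)/(1 - Q^2) = 1/(1 - Q): two series of ratio q^2, offset by a factor
    q, interleave into one of ratio q. *)
Lemma geom_pair_sum (q c : R) (r : nat) :
  (0 < q < 1)%R -> (0 < r)%nat ->
  (c ^ r / (1 - (q ^ 2) ^ r) + (c * q) ^ r / (1 - (q ^ 2) ^ r) = c ^ r / (1 - q ^ r))%R.
Proof.
intros Hq Hr; destruct r as [|r]; [lia | ].
assert (H := pow_lt_1_S q r Hq).
rewrite Rpow_mult_distr -(pow_mult q 2) Nat.mul_comm (pow_mult q _ 2).
set (Q := (q ^ S r)%R) in *; clearbody Q; field; split; nra.
Qed.

(** Both sums have ratio q^2; their leading terms are v^2 and u^2 v^4 = v^2 q, as [geom_pair_sum]
    requires. *)
Lemma coef_a_eq (u v : R) (r : nat) :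
  (0 < u < 1)%R -> (0 < v < 1)%R -> (0 < r)%nat ->
  coef_a u v r = ((v ^ 2) ^ r / (1 - qq u v ^ r))%R.
Proof.
intros Hu Hv Hr; assert (Hq := qq_bounds u v Hu Hv).
assert (Hq2 : (0 < qq u v ^ 2 < 1)%R) by (assert (H := pow_lt_1_S _ 1 Hq); lra).
rewrite -geom_pair_sum //; unfold coef_a; f_equal; apply Rseries1_geom_pow; trivial;
  intros k; rewrite -pow_4_qq.
- replace (4 * S k - 4)%nat with (4 * k)%nat by lia.
  replace (4 * S k - 2)%nat with (4 * k + 2)%nat by lia.
  rewrite pow_add; ring.
- replace (4 * S k - 2)%nat with (4 * k + 2)%nat by lia.
  replace (4 * S k)%nat with (4 * k + 4)%nat by lia.
  rewrite !pow_add; unfold qq; ring.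
Qed.

Lemma coef_b_eq (u v : R) (r : nat) :
  (0 < u < 1)%R -> (0 < v < 1)%R -> (0 < r)%nat ->
  coef_b u v r = ((u ^ 2) ^ r / (1 - qq u v ^ r))%R.
Proof.
intros Hu Hv Hr; assert (Hq := qq_bounds u v Hu Hv).
assert (Hq2 : (0 < qq u v ^ 2 < 1)%R) by (assert (H := pow_lt_1_S _ 1 Hq); lra).
rewrite -geom_pair_sum //; unfold coef_b; f_equal; apply Rseries1_geom_pow; trivial;
  intros k; rewrite -pow_4_qq.
- replace (4 * S k - 4)%nat with (4 * k)%nat by lia.
  replace (4 * S k - 2)%nat with (4 * k + 2)%nat by lia.
  rewrite pow_add; ring.
- replace (4 * S k - 2)%nat with (4 * k + 2)%nat by lia.
  replace (4 * S k)%nat with (4 * k + 4)%nat by lia.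
  rewrite !pow_add; unfold qq; ring.
Qed.

Lemma coef_c_eq (u v : R) (r : nat) :
  (0 < u < 1)%R -> (0 < v < 1)%R -> (0 < r)%nat ->
  coef_c u v r = (qq u v ^ r / (1 - qq u v ^ r))%R.
Proof.
intros Hu Hv Hr; apply Rseries1_geom_pow; trivial; [now apply qq_bounds | ].
intros k; rewrite !pow_mult -Rpow_mult_distr; reflexivity.
Qed.

Lemma pow_qq_bounds (u v : R) (r : nat) :
  (0 < u < 1)%R -> (0 < v < 1)%R -> (0 < qq u v ^ S r < 1)%R.
Proof.
intros Hu Hv; assert (Hq := qq_bounds u v Hu Hv).
assert (H := pow_lt_1_S (qq u v) r Hq); lra.
Qed.

(** The closed forms of a_r, b_r and c_r share the denominator 1 - q^r; the numerator q^r of c_r is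
    absorbed into the arguments q w/z and q z/w. *)
Lemma B_term_split (u v : R) (z w : C) (r : nat) :
  (0 < u < 1)%R -> (0 < v < 1)%R -> z <> 0 -> w <> 0 ->
  B_term u v z w (S r) =
    A_term (qq u v) ((v ^ 2)%R / (z * w)) (S r) + A_term (qq u v) ((u ^ 2)%R * (z * w)) (S r)
    + A_term (qq u v) (qq u v * (w / z)) (S r) + A_term (qq u v) (qq u v * (z / w)) (S r).
Proof.
intros Hu Hv Hz Hw.
assert (Hq := pow_qq_bounds u v r Hu Hv).
assert (HC : forall x : R, RtoC (x ^ S r / (1 - qq u v ^ S r))
  = RtoC x ^ S r / (1 - RtoC (qq u v) ^ S r)).
{ intros x; rewrite RtoC_div; [ | lra]; now rewrite RtoC_minus !RtoC_pow. }
unfold B_term, A_term; rewrite coef_a_eq ?coef_b_eq ?coef_c_eq; trivial; try lia.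
rewrite !HC; unfold Cdiv.
assert (Hzw : z * w <> 0) by now apply Cmult_neq_0.
generalize (RtoC (u ^ 2)) (RtoC (v ^ 2)); intros u2 v2.
rewrite !Cpow_mult_l !Cpow_inv // Cpow_mult_l.
assert (Hz' := Cpow_nz z (S r) Hz); assert (Hw' := Cpow_nz w (S r) Hw).
assert (Hd : 1 - RtoC (qq u v) ^ S r <> 0).
{ rewrite -RtoC_pow -RtoC_minus; intros E; apply RtoC_inj in E; lra. }
field; repeat split; trivial.
Qed.

Lemma is_series_B_term (u v : R) (z w : C) :
  (0 < u < 1)%R -> (0 < v < 1)%R -> z <> 0 -> w <> 0 ->
  (Cmod ((v ^ 2)%R / (z * w)) < 1)%R -> (Cmod ((u ^ 2)%R * (z * w)) < 1)%R ->
  (Cmod (qq u v * (w / z)) < 1)%R -> (Cmod (qq u v * (z / w)) < 1)%R ->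
  @is_series C_AbsRing C_NormedModule (fun n => B_term u v z w (S n))
    (Aq (qq u v) ((v ^ 2)%R / (z * w)) + Aq (qq u v) ((u ^ 2)%R * (z * w))
     + Aq (qq u v) (qq u v * (w / z)) + Aq (qq u v) (qq u v * (z / w))).
Proof.
intros Hu Hv Hz Hw H1 H2 H3 H4.
assert (Hq := qq_bounds u v Hu Hv).
rewrite !Aq_Cps //.
eapply is_series_ext; [intros n; symmetry; now apply B_term_split | ].
apply: (is_series_plus (V := C_NormedModule)); [ | now apply is_series_A_term].
apply: (is_series_plus (V := C_NormedModule)); [ | now apply is_series_A_term].
apply: (is_series_plus (V := C_NormedModule)); now apply is_series_A_term.
Qed.

(** * The double pole on the diagonal *)

Lemma CV_radius_INR : Rbar_le 1 (CV_radius INR).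
Proof.
rewrite -(CV_radius_ext (PS_euler (fun _ => 1%R))).
- rewrite CV_radius_euler; apply CV_radius_ones.
- intros n; unfold PS_euler; ring.
Qed.

(** Writing the shifted coefficient as n + 1 gives S = x (S + 1/(1 - x)) for the sum S. *)
Lemma Cps_INR (x : C) : (Cmod x < 1)%R -> Cps INR x = x / (1 - x) ^ 2.
Proof.
intros Hx.
assert (H1 := Cminus_1_neq_0 x Hx).
assert (Hr1 := CV_radius_ones); assert (Hr := CV_radius_INR).
assert (E : Cps INR x = x * (Cps INR x + / (1 - x))).
{ rewrite {1}Cps_decr_1 //; simpl INR; rewrite Cplus_0_l; f_equal.
  rewrite -Cps_geom // -Cseries_plus; try now apply ex_series_Cps.
  apply Cseries_ext.
  - intros n; unfold PS_decr_1; rewrite S_INR RtoC_plus; ring.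
  - apply: (ex_series_plus (V := C_NormedModule)); now apply ex_series_Cps. }
assert (E' : Cps INR x * (1 - x) = x / (1 - x)).
{ transitivity (Cps INR x - x * Cps INR x); [ring | ].
  rewrite {1}E; field; exact H1. }
transitivity (Cps INR x * (1 - x) / (1 - x)); [field; exact H1 | ].
rewrite E'; field; exact H1.
Qed.

(** The coefficients of the difference are r (1 - q^r)/(1 - q^r) = r. At x = w/z the rational term
    is z w/(z - w)^2, the part that separates the annular kernel from B. *)
Lemma Aq_shift (q : R) (x : C) :
  (0 < q < 1)%R -> (Cmod x < 1)%R -> Aq q x = x / (1 - x) ^ 2 + Aq q (q * x).
Proof.
intros Hq Hx.
assert (Hqx := Cmod_scal_lt_1 q x ltac:(lra) Hx).
assert (Hr := CV_radius_INR).
set (a := PS_euler (PS_euler (PS_psi q))).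
assert (Ha : Rbar_le 1 (CV_radius a)).
{ unfold a; rewrite !CV_radius_euler; now apply CV_radius_psi. }
rewrite !Aq_Cps // -/a -Cps_INR // -Cseries_plus; try now apply ex_series_Cps.
apply Cseries_ext.
2:{ apply: (ex_series_plus (V := C_NormedModule)); now apply ex_series_Cps. }
intros n; rewrite Cpow_mult_l -RtoC_pow Cmult_assoc -RtoC_mult -Cmult_plus_distr_r -RtoC_plus.
do 2 f_equal; unfold a; rewrite !PS_euler_euler_psi //; destruct n as [|n].
- simpl; unfold Rdiv; ring.
- assert (Hn := pow_lt_1_S q n Hq); field; lra.
Qed.

(** * The image potential *)

Lemma is_derive_Cinv (z : C) :
  z <> 0 -> @is_derive C_AbsRing (AbsRing_NormedModule C_AbsRing) Cinv z (- / (z * z)).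
Proof.
intros Hz; split; [apply is_linear_scal_l | ].
intros z0 Hz0 eps.
apply (is_filter_lim_locally_unique (K := C_AbsRing) (V := AbsRing_NormedModule C_AbsRing)) in Hz0.
subst z0.
assert (Hm : (0 < Cmod z)%R) by now apply Cmod_gt_0.
set (m := Cmod z) in Hm.
(* The remainder is (y-z)^2 / (y z^2). The first bound gives |y| >= m/2, hence |y z^2| >= m^3/2; the
   second then yields the factor [eps]. *)
set (del := Rmin (m / 2) (eps * m ^ 3 / 2)).
assert (Hm3 : (0 < m ^ 3)%R) by now apply pow_lt.
assert (Hdel : (0 < del)%R).
{ apply Rmin_pos; [lra | ]. assert (H := cond_pos eps); nra. }
exists (mkposreal del Hdel); intros y Hy; change C in y.
change (Cmod (y - z) < del)%R in Hy.
change (Cmod (/ y - / z - (y - z) * - / (z * z)) <= eps * Cmod (y - z))%R.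
assert (H1 : (del <= m / 2)%R) by apply Rmin_l.
assert (H2 : (del <= eps * m ^ 3 / 2)%R) by apply Rmin_r.
assert (Hym : (m / 2 <= Cmod y)%R).
{ assert (Ht := Cmod_triangle y (z - y)).
  replace (y + (z - y)) with z in Ht by ring.
  replace (z - y) with (- (y - z)) in Ht by ring; rewrite Cmod_opp in Ht; fold m in Ht; lra. }
assert (Hy0 : y <> 0) by (apply Cmod_gt_0; lra).
replace (/ y - / z - (y - z) * - / (z * z)) with ((y - z) * ((y - z) * / (y * (z * z))))
  by (field; split; trivial).
rewrite Cmod_mult Rmult_comm; apply Rmult_le_compat_r; [apply Cmod_ge_0 | ].
rewrite Cmod_mult Cmod_inv; [ | repeat apply Cmult_neq_0; trivial].
rewrite !Cmod_mult; fold m.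
assert (Hp : (m ^ 3 / 2 <= Cmod y * (m * m))%R).
{ replace (m ^ 3 / 2)%R with (m / 2 * (m * m))%R by (simpl; field).
  apply Rmult_le_compat_r; nra. }
apply Rmult_le_reg_r with (Cmod y * (m * m))%R; [lra | ].
rewrite Rmult_assoc Rinv_l; [ | lra].
assert (H := cond_pos eps); nra.
Qed.

(** The derivative of [g] is written e g(w)/w because [g] will be a monomial of degree e = 1 or -1
    in w; the Euler derivative of the composite is then e times the Euler series at g(w). *)
Lemma is_derive_Cps_comp (a : nat -> R) (g : C -> C) (e w : C) :
  Rbar_le 1 (CV_radius a) -> (Cmod (g w) < 1)%R ->
  @is_derive C_AbsRing (AbsRing_NormedModule C_AbsRing) g w (e * g w / w) ->
  @is_derive C_AbsRing C_NormedModule (fun y => Cps a (g y)) w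
    (e * Cps (PS_euler a) (g w) / w).
Proof.
intros Ha Hg Hd.
rewrite Cps_euler //.
replace (e * (g w * Cps (PS_derive a) (g w)) / w) with
  (e * g w / w * Cps (PS_derive a) (g w)) by (unfold Cdiv; ring).
apply (is_derive_comp (K := C_AbsRing) (V := C_NormedModule) (Cps a) g); trivial.
now apply is_derive_Cps.
Qed.

Lemma is_derive_Cscal (s : C) (f : C -> C) (x d : C) :
  @is_derive C_AbsRing C_NormedModule f x d ->
  @is_derive C_AbsRing C_NormedModule (fun y => s * f y) x (s * d).
Proof.
intros H.
apply (filterdiff_ext_lin (U := AbsRing_NormedModule C_AbsRing) (V := C_NormedModule) _ (fun y : C => scal s (scal y d))).
- exact (filterdiff_scal_r_fct (U := AbsRing_NormedModule C_AbsRing) (V := C_NormedModule) s _ _ Cmult_comm H).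
- intros y; change (@eq C (s * (y * d)) (y * (s * d))); ring.
Qed.

Lemma is_derive_Cmult_const (c w : C) :
  @is_derive C_AbsRing (AbsRing_NormedModule C_AbsRing) (fun y => c * y) w c.
Proof.
rewrite -[X in is_derive _ _ X](_ : 0 * w + c * 1 = c); [ | ring].
apply (is_derive_mult (K := C_AbsRing) (fun _ => c) (fun y => y) w (RtoC 0) (RtoC 1)).
- apply (is_derive_const (V := AbsRing_NormedModule C_AbsRing)).
- apply (is_derive_id (K := C_AbsRing)).
- apply Cmult_comm.
Qed.

Lemma is_derive_Cdiv_const (c w : C) :
  w <> 0 ->
  @is_derive C_AbsRing (AbsRing_NormedModule C_AbsRing) (fun y => c / y) w (- c / (w * w)).
Proof.
intros Hw.
replace (- c / (w * w)) with (0 * / w + c * - / (w * w)) by (field; trivial).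
apply (is_derive_mult (K := C_AbsRing) (fun _ => c) Cinv w (RtoC 0) (- / (w * w))).
- apply (is_derive_const (V := AbsRing_NormedModule C_AbsRing)).
- now apply is_derive_Cinv.
- apply Cmult_comm.
Qed.

(** Common to both variables: of the four arguments, two are proportional to the variable and two to
    its inverse. It is applied with coefficients of [psi] in w, then with their Euler transform in
    z. *)
Lemma is_derive_Cps_four (a : nat -> R) (s1 s2 s3 s4 c1 c2 c3 c4 k w : C) :
  Rbar_le 1 (CV_radius a) -> w <> 0 ->
  (Cmod (c1 * w) < 1)%R -> (Cmod (c2 * w) < 1)%R ->
  (Cmod (c3 / w) < 1)%R -> (Cmod (c4 / w) < 1)%R ->
  @is_derive C_AbsRing C_NormedModule
    (fun y => s1 * Cps a (c1 * y) + s2 * Cps a (c2 * y)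
              + s3 * Cps a (c3 / y) + s4 * Cps a (c4 / y) + k) w
    ((s1 * Cps (PS_euler a) (c1 * w) + s2 * Cps (PS_euler a) (c2 * w)
      - s3 * Cps (PS_euler a) (c3 / w) - s4 * Cps (PS_euler a) (c4 / w)) / w).
Proof.
intros Ha Hw H1 H2 H3 H4.
assert (Hm : forall s c, (Cmod (c * w) < 1)%R ->
  @is_derive C_AbsRing C_NormedModule (fun y => s * Cps a (c * y)) w
    (s * (1 * Cps (PS_euler a) (c * w) / w))).
{ intros s c Hc; apply is_derive_Cscal.
  apply is_derive_Cps_comp; trivial.
  replace (1 * (c * w) / w) with c by (field; trivial); apply is_derive_Cmult_const. }
assert (Hd : forall s c, (Cmod (c / w) < 1)%R ->
  @is_derive C_AbsRing C_NormedModule (fun y => s * Cps a (c / y)) w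
    (s * (-1 * Cps (PS_euler a) (c / w) / w))).
{ intros s c Hc; apply is_derive_Cscal.
  apply is_derive_Cps_comp; trivial.
  replace (-1 * (c / w) / w) with (- c / (w * w)) by (field; trivial).
  now apply is_derive_Cdiv_const. }
replace (_ / w) with (s1 * (1 * Cps (PS_euler a) (c1 * w) / w)
  + s2 * (1 * Cps (PS_euler a) (c2 * w) / w)
  + s3 * (-1 * Cps (PS_euler a) (c3 / w) / w)
  + s4 * (-1 * Cps (PS_euler a) (c4 / w) / w) + 0) by (field; trivial).
repeat apply: (is_derive_plus (V := C_NormedModule)); auto.
apply: (is_derive_const (V := C_NormedModule)).
Qed.

(** * Continuity of the four arguments and neighbourhoods in the product *)

Lemma continuous_C_iff {T : UniformSpace} (f : T -> C) (p : T) :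
  continuous (U := C_UniformSpace) f p <->
  continuous (U := AbsRing_UniformSpace C_AbsRing) f p.
Proof. split; intros H P HP; apply H; now apply locally_C. Qed.

Lemma continuous_Cmult {T : UniformSpace} (f g : T -> C) (p : T) :
  continuous (U := C_UniformSpace) f p -> continuous (U := C_UniformSpace) g p ->
  continuous (U := C_UniformSpace) (fun r => f r * g r) p.
Proof.
intros Hf Hg; apply continuous_C_iff.
apply (continuous_mult (K := C_AbsRing)); now apply continuous_C_iff.
Qed.

Lemma continuous_Cinv {T : UniformSpace} (f : T -> C) (p : T) :
  f p <> 0 -> continuous (U := C_UniformSpace) f p ->
  continuous (U := C_UniformSpace) (fun r => / f r) p.
Proof.
intros H0 Hf; apply continuous_C_iff; apply continuous_C_iff in Hf.
apply (continuous_comp (V := AbsRing_UniformSpace C_AbsRing)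
  (W := AbsRing_UniformSpace C_AbsRing) f Cinv); trivial.
apply (ex_derive_continuous (K := C_AbsRing) (V := AbsRing_NormedModule C_AbsRing)).
eexists; now apply is_derive_Cinv.
Qed.

Lemma locally_C_neq_0 (w : C) :
  w <> 0 -> @locally C_UniformSpace w (fun y : C => y <> 0).
Proof.
intros Hw; apply (locally_Cmod _ _ (Cmod w)); [now apply Cmod_gt_0 | ].
intros y Hy E; subst y; replace (0 - w) with (- w) in Hy by ring.
rewrite Cmod_opp in Hy; lra.
Qed.

(** Turns a joint neighbourhood into the iterated one that successive partial derivatives
    require. *)
Lemma locally_prod_curry {T V : UniformSpace} (x : T) (y : V) (P : T * V -> Prop) :
  locally (T := prod_UniformSpace T V) (x, y) P ->
  locally x (fun x' => locally y (fun y' => P (x', y'))).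
Proof.
intros [eps H]; exists eps; intros x' Hx'; exists eps; intros y' Hy'.
now apply H; split.
Qed.

Local Notation CxC := (prod_UniformSpace C_UniformSpace C_UniformSpace).

Lemma continuous_arguments (u v : R) (z w : C) :
  z <> 0 -> w <> 0 ->
  let cont (x : C * C -> C) :=
    @continuous CxC C_UniformSpace x (z, w) in
  cont x_wz /\ cont (x_qzw u v) /\ cont (x_uu u) /\ cont (x_vv v).
Proof.
intros Hz Hw cont.
assert (Hf : cont fst) by apply (continuous_fst (U := C_UniformSpace) (V := C_UniformSpace)).
assert (Hs : cont snd) by apply (continuous_snd (U := C_UniformSpace) (V := C_UniformSpace)).
assert (Hc : forall c, cont (fun _ => c)) by (intros c; apply continuous_const).
assert (Hm : forall f g, cont f -> cont g -> cont (fun p => f p * g p))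
  by exact (fun f g => continuous_Cmult (T := CxC) f g (z, w)).
assert (Hi : forall f : C * C -> C, f (z, w) <> 0 -> cont f -> cont (fun p => / f p))
  by exact (fun f => continuous_Cinv (T := CxC) f (z, w)).
split; [ | split; [ | split]].
- exact (Hm _ _ Hs (Hi fst Hz Hf)).
- exact (Hm _ _ (Hc _) (Hm _ _ Hf (Hi snd Hw Hs))).
- exact (Hm _ _ (Hc _) (Hm _ _ Hf Hs)).
- exact (Hm _ _ (Hc _) (Hi _ (Cmult_neq_0 _ _ Hz Hw) (Hm _ _ Hf Hs))).
Qed.

(** The reference logarithm of [image_quotient] where all four arguments lie in the unit disc; by
    [qpoch_cexp], numerator factors enter with a minus sign. *)
Definition image_log (u v : R) (p : C * C) : C :=
  - psi (qq u v) (x_wz p) - psi (qq u v) (x_qzw u v p)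
  + psi (qq u v) (x_uu u p) + psi (qq u v) (x_vv v p).

Lemma image_potential_mixed_euler (u v : R) (U : C * C -> Prop) (L : C * C -> C) (z w : C) :
  (0 < u < 1)%R -> (0 < v < 1)%R ->
  image_potential u v U L -> U (z, w) ->
  (Cmod (x_wz (z, w)) < 1)%R -> (Cmod (x_qzw u v (z, w)) < 1)%R ->
  (Cmod (x_uu u (z, w)) < 1)%R -> (Cmod (x_vv v (z, w)) < 1)%R ->
  @locally C_UniformSpace z (fun z' => C_ex_derive (fun w' => L (z', w')) w)
  /\ C_ex_derive (fun z' => euler (fun w' => L (z', w')) w) z
  /\ euler (fun z' => euler (fun w' => L (z', w')) w) z = Kann u v z w.
Proof.
intros Hu Hv (HU & Hnz & _ & _ & _ & _ & HL) HUzw H1 H2 H3 H4.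
assert (Hq := qq_bounds u v Hu Hv).
assert (Hr := CV_radius_psi _ Hq).
destruct (Hnz _ HUzw) as [Hz Hw]; simpl in Hz, Hw.
destruct (continuous_arguments u v z w Hz Hw) as (C1 & C2 & C3 & C4).
set (good := fun p => U p /\ (Cmod (x_wz p) < 1)%R /\ (Cmod (x_qzw u v p) < 1)%R
  /\ (Cmod (x_uu u p) < 1)%R /\ (Cmod (x_vv v p) < 1)%R).
assert (Hgood : @locally CxC (z, w) good).
{ assert (Hlt : forall x : C * C -> C,
    @continuous CxC C_UniformSpace x (z, w) ->
    (Cmod (x (z, w)) < 1)%R ->
    @locally CxC (z, w)
      (fun p => (Cmod (x p) < 1)%R)).
  { intros x Hx Hx1; exact (Hx _ (locally_Cmod_lt _ _ Hx1)). }
  exact (filter_and _ _ (HU _ HUzw) (filter_and _ _ (Hlt _ C1 H1) (filter_and _ _ (Hlt _ C2 H2)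
    (filter_and _ _ (Hlt _ C3 H3) (Hlt _ C4 H4))))). }
assert (Hcpsi : forall x : C * C -> C,
  @continuous CxC C_UniformSpace x (z, w) ->
  (Cmod (x (z, w)) < 1)%R ->
  @continuous CxC C_UniformSpace
    (fun p => psi (qq u v) (x p)) (z, w)).
{ intros x Hx Hx1.
  apply (continuous_comp (U := CxC)
    (V := C_UniformSpace) (W := C_UniformSpace) x (psi (qq u v))); trivial.
  now apply continuous_Cps. }
assert (Hloc : @locally CxC (z, w)
  (fun p => L p = image_log u v p + (L (z, w) - image_log u v (z, w)))).
{ apply (logs_differ_by_const (T := CxC) L).
  - apply (HL _ HUzw).
  - assert (Hp := fun f g : CxC -> C =>
      continuous_plus (U := CxC) (V := C_NormedModule) f g (z, w)).
    assert (Ho := fun f : CxC -> C =>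
      continuous_opp (U := CxC) (V := C_NormedModule) f (z, w)).
    exact (Hp _ _ (Hp _ _ (Hp _ _ (Ho _ (Hcpsi _ C1 H1)) (Ho _ (Hcpsi _ C2 H2)))
      (Hcpsi _ C3 H3)) (Hcpsi _ C4 H4)).
  - revert Hgood; apply filter_imp; intros p (HUp & G1 & G2 & G3 & G4).
    rewrite (proj2 (HL _ HUp)); unfold image_quotient, image_log.
    rewrite !qpoch_cexp // /Cminus !cexp_plus !cexp_opp.
    field; repeat split; apply cexp_neq_0. }
set (k := L (z, w) - image_log u v (z, w)) in Hloc.
set (a1 := PS_euler (PS_psi (qq u v))).
assert (Hr1 : Rbar_le 1 (CV_radius a1)) by now unfold a1; rewrite CV_radius_euler.
(* The Euler derivative in w: [x_wz] and [x_uu] have degree 1 in w, [x_qzw] and [x_vv] degree -1, so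
   the signs of the last two flip relative to [image_log]. *)
set (E1 := fun z' => Cps a1 (x_uu u (z', w)) - Cps a1 (x_wz (z', w))
  + Cps a1 (x_qzw u v (z', w)) - Cps a1 (x_vv v (z', w))).
assert (Hd1 : @locally C_UniformSpace z (fun z' =>
  @is_derive C_AbsRing C_NormedModule (fun w' => L (z', w')) w (E1 z' / w))).
{ assert (Hloc' := locally_prod_curry _ _ _ Hloc).
  assert (Hgood' := locally_prod_curry _ _ _ Hgood).
  generalize (filter_and _ _ Hloc' Hgood'); apply filter_imp; intros z' [Hz' Hg'].
  apply locally_singleton in Hg'; destruct Hg' as (HU' & G1 & G2 & G3 & G4).
  destruct (Hnz _ HU') as [Hz0 _]; simpl in Hz0.
  assert (X1 : forall w', x_wz (z', w') = / z' * w').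
  { intros w'; unfold x_wz, Cdiv; simpl; ring. }
  assert (X3 : forall w', x_uu u (z', w') = (u ^ 2)%R * z' * w').
  { intros w'; unfold x_uu; cbn [fst snd]; ring. }
  assert (X2 : forall w', x_qzw u v (z', w') = (qq u v * z') / w').
  { intros w'; unfold x_qzw, Cdiv; cbn [fst snd]; ring. }
  assert (X4 : x_vv v (z', w) = ((v ^ 2)%R / z') / w).
  { unfold x_vv; cbn [fst snd]; field; split; trivial. }
  rewrite X1 in G1; rewrite X2 in G2; rewrite X3 in G3; rewrite X4 in G4.
  apply is_derive_C_ext_loc with (fun w' =>
    -1 * psi (qq u v) (/ z' * w') + 1 * psi (qq u v) ((u ^ 2)%R * z' * w')
    + -1 * psi (qq u v) ((qq u v * z') / w') + 1 * psi (qq u v) (((v ^ 2)%R / z') / w') + k).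
  (* Factoring 1/(z' w') needs w' nonzero, which holds near w. *)
  - assert (Hwn := locally_C_neq_0 w Hw).
    generalize (filter_and _ _ Hz' Hwn); apply filter_imp; intros w' [E Hw'].
    assert (X4' : x_vv v (z', w') = ((v ^ 2)%R / z') / w').
    { unfold x_vv; cbn [fst snd]; field; split; trivial. }
    rewrite E; unfold image_log; rewrite X1 X2 X3 X4'; ring.
  - replace (E1 z' / w) with
      ((-1 * Cps a1 (/ z' * w) + 1 * Cps a1 ((u ^ 2)%R * z' * w)
        - -1 * Cps a1 ((qq u v * z') / w) - 1 * Cps a1 (((v ^ 2)%R / z') / w)) / w).
    + now apply is_derive_Cps_four.
    + unfold E1; rewrite X1 X2 X3 X4; field; trivial. }
assert (He : @locally C_UniformSpace z (fun z' => euler (fun w' => L (z', w')) w = E1 z')).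
{ revert Hd1; apply filter_imp; intros z' Hz'; unfold euler.
  rewrite (is_C_derive_unique _ _ _ Hz'); field; trivial. }
assert (Y1 : x_wz (z, w) = w / z) by reflexivity.
assert (Y2 : x_qzw u v (z, w) = (qq u v / w) * z) by (unfold x_qzw, Cdiv; cbn [fst snd]; ring).
assert (Y3 : x_uu u (z, w) = ((u ^ 2)%R * w) * z) by (unfold x_uu; cbn [fst snd]; ring).
assert (Y4 : x_vv v (z, w) = ((v ^ 2)%R / w) / z)
  by (unfold x_vv; cbn [fst snd]; field; split; trivial).
assert (Hd2 : @is_derive C_AbsRing C_NormedModule
  (fun z' => euler (fun w' => L (z', w')) w) z (Kann u v z w / z)).
(* Regrouped for z: now [x_uu] and [x_qzw] have degree 1, and [x_wz] and [x_vv], which carry minus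
   signs in [E1], have degree -1. *)
{ apply (is_derive_C_ext_loc _ (fun z' =>
    1 * Cps a1 (((u ^ 2)%R * w) * z') + 1 * Cps a1 ((qq u v / w) * z')
    + -1 * Cps a1 (w / z') + -1 * Cps a1 (((v ^ 2)%R / w) / z') + 0)).
  - assert (Hzn := locally_C_neq_0 z Hz).
    generalize (filter_and _ _ He Hzn); apply filter_imp; intros z' [E Hz']; change C in z'.
    rewrite E; unfold E1.
    replace (x_qzw u v (z', w)) with ((qq u v / w) * z')
      by (unfold x_qzw, Cdiv; cbn [fst snd]; ring).
    replace (x_uu u (z', w)) with (((u ^ 2)%R * w) * z') by (unfold x_uu; cbn [fst snd]; ring).
    replace (x_vv v (z', w)) with (((v ^ 2)%R / w) / z')
      by (unfold x_vv; cbn [fst snd]; field; split; trivial).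
    unfold x_wz; cbn [fst snd]; ring.
  - replace (Kann u v z w / z) with
      ((1 * Cps (PS_euler a1) (((u ^ 2)%R * w) * z) + 1 * Cps (PS_euler a1) ((qq u v / w) * z)
        - -1 * Cps (PS_euler a1) (w / z) - -1 * Cps (PS_euler a1) (((v ^ 2)%R / w) / z)) / z).
    + rewrite Y1 in H1; rewrite Y2 in H2; rewrite Y3 in H3; rewrite Y4 in H4.
      now apply is_derive_Cps_four.
    + unfold Kann; rewrite !Aq_Cps // -Y2 -Y3 -Y4 Y1; unfold a1; field; trivial. }
split; [ | split].
- revert Hd1; apply filter_imp; intros z' Hz'; eexists; exact Hz'.
- eexists; exact Hd2.
- unfold euler at 1; rewrite (is_C_derive_unique _ _ _ Hd2); field; trivial.
Qed.


Theorem proposition5p14 :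
  forall u v : R, (0 < u < 1)%R -> (0 < v < 1)%R ->
  (* A_q = (x d/dx)^2 [- log (x; q)_oo] *)
  (forall (U : C -> Prop) (l : C -> C),
     @open C_UniformSpace U ->
     @log_branch C_UniformSpace U (fun x => qpoch x (qq u v)) l ->
     forall x, U x -> (Cmod x < 1)%R ->
       @locally C_UniformSpace x (C_ex_derive (fun y => - l y))
       /\ C_ex_derive (euler (fun y => - l y)) x
       /\ Aq (qq u v) x = euler (euler (fun y => - l y)) x)
  /\
  forall Gz Gw : C -> Prop,
  (forall z, Gz z -> z <> 0) ->
  (forall w, Gw w -> w <> 0) ->
  (* decomposition of B *)
  (A_normal (contour_product Gz Gw) (qq u v) (x_vv v) ->
   A_normal (contour_product Gz Gw) (qq u v) (x_uu u) ->
   A_normal (contour_product Gz Gw) (qq u v) (x_qwz u v) ->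
   A_normal (contour_product Gz Gw) (qq u v) (x_qzw u v) ->
   forall z w, Gz z -> Gw w ->
     @ex_series C_AbsRing C_NormedModule (fun n => B_term u v z w (S n))
     /\ Bker u v z w
        = Aq (qq u v) ((v ^ 2)%R / (z * w)) + Aq (qq u v) ((u ^ 2)%R * (z * w))
          + Aq (qq u v) (qq u v * (w / z)) + Aq (qq u v) (qq u v * (z / w)))
  /\
  (* nested contours *)
  (A_normal (contour_product Gz Gw) (qq u v) x_wz ->
   A_normal (contour_product Gz Gw) (qq u v) (x_qzw u v) ->
   A_normal (contour_product Gz Gw) (qq u v) (x_uu u) ->
   A_normal (contour_product Gz Gw) (qq u v) (x_vv v) ->
   (forall z w, Gz z -> Gw w -> (Cmod w < Cmod z)%R) ->
   (forall z w, Gz z -> Gw w ->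
      z * w / (z - w) ^ 2 + Bker u v z w = Kann u v z w)
   /\
   (forall (U : C * C -> Prop) (L : C * C -> C),
      image_potential u v U L ->
      (forall p, contour_product Gz Gw p -> U p) ->
      forall z w, Gz z -> Gw w ->
        @locally C_UniformSpace z (fun z' => C_ex_derive (fun w' => L (z', w')) w)
        /\ C_ex_derive (fun z' => euler (fun w' => L (z', w')) w) z
        /\ euler (fun z' => euler (fun w' => L (z', w')) w) z = Kann u v z w)).

Proof.
intros u v Hu Hv.
assert (Hq := qq_bounds u v Hu Hv).
split.
{ intros U l HU Hl x Ux Hx; now apply (qpoch_log_second_euler _ U). }
intros Gz Gw HGz HGw.
split.
- intros N1 N2 N3 N4 z w Hz Hw.
  assert (HD : contour_product Gz Gw (z, w)) by now split.
  assert (HB := is_series_B_term u v z w Hu Hv (HGz z Hz) (HGw w Hw)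
    (A_normal_Cmod_lt _ _ _ _ Hq N1 HD) (A_normal_Cmod_lt _ _ _ _ Hq N2 HD)
    (A_normal_Cmod_lt _ _ _ _ Hq N3 HD) (A_normal_Cmod_lt _ _ _ _ Hq N4 HD)).
  split; [eexists; exact HB | now apply is_Cseries_unique].
- intros N1 N2 N3 N4 _.
  assert (Hlt : forall z w, Gz z -> Gw w ->
    (Cmod (x_wz (z, w)) < 1 /\ Cmod (x_qzw u v (z, w)) < 1
     /\ Cmod (x_uu u (z, w)) < 1 /\ Cmod (x_vv v (z, w)) < 1)%R).
  { intros z w Hz Hw; assert (HD : contour_product Gz Gw (z, w)) by now split.
    repeat split; eapply A_normal_Cmod_lt; eassumption. }
  split.
  + intros z w Hz Hw; destruct (Hlt z w Hz Hw) as (H1 & H2 & H3 & H4).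
    assert (Hz0 := HGz z Hz); assert (Hw0 := HGw w Hw).
    (* The series for B involves q w/z, whose modulus is below 1 because that of w/z is. *)
    assert (H5 := Cmod_scal_lt_1 (qq u v) _ ltac:(lra) H1).
    unfold Bker, Cseries1; rewrite (is_Cseries_unique _ _ (is_series_B_term u v z w Hu Hv Hz0 Hw0 H4 H3 H5 H2)).
    unfold Kann; rewrite (Aq_shift _ (x_wz (z, w))) //.
    unfold x_wz, x_uu, x_vv, x_qzw; cbn [fst snd].
    (* z = w would put w/z = 1 on the boundary of the disc. *)
    assert (Hzw : z - w <> 0).
    { intros E; apply (Cminus_1_neq_0 _ H1); unfold x_wz; cbn [fst snd].
      replace (1 - w / z) with ((z - w) / z) by (field; trivial).
      rewrite E; unfold Cdiv; ring. }
    field; repeat split; trivial.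
  + intros U L HL HU z w Hz Hw; destruct (Hlt z w Hz Hw) as (H1 & H2 & H3 & H4).
    apply (image_potential_mixed_euler u v U); trivial; now apply HU.
Qed.
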